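(* Let $d\geq 2$, let $C=Z(\mathbb{R}_+^d)$ for some linear automorphism $Z$ of $\mathbb{R}^d$, and let $\mathcal{S}\subset\mathbb{R}^d$ be a finite set with weights $a(s)\geq 0$ ($s\in\mathcal{S}$) satisfying $\sum_{s\in\mathcal{S}}a(s)=1$, $\sum_{s\in\mathcal{S}}a(s)s=0$ and $\sum_{s\in\mathcal{S}}a(s)s_is_j=\delta_{i,j}$ for all $i,j\in\{1,\dots,d\}$. (i) If there exists an $\mathrm{a}^+$-polynomial $P$ on $C$ (for $L_{\mathcal{S}}$), then $P$ is unique (up to a positive multiplicative constant) and $C$ is a Weyl chamber of a finite Coxeter group. (ii) If $d=2$ and $C$ is a Weyl chamber of a finite Coxeter group (i.e., if the interior angle of $C$ has the form $\pi/n$ for some positive integer $n$), then there exists an $\mathrm{a}^+$-polynomial on $C$ (for $L_{\mathcal{S}}$).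
   Context: Here $\mathbb{R}_+=[0,\infty)$, $s=(s_1,\dots,s_d)$ are the coordinates of $s$ in the canonical basis, and $\delta_{i,j}$ is the Kronecker symbol. The discrete Laplacian is $L_{\mathcal{S}}(f)(x)=\sum_{s\in\mathcal{S}}a(s)f(x+s)-f(x)$ for $f:\mathbb{R}^d\to\mathbb{R}$. A function $f$ is discrete harmonic on $D$ if $L_{\mathcal{S}}(f)(x)=0$ for all $x\in D$. The dominant term of a nonzero polynomial is its homogeneous component of highest degree. A real polynomial $P$ in $d$ variables is an $\mathrm{a}^+$-polynomial on $C$ if it is discrete harmonic on $C$, vanishes on the boundary $\partial C$, and is asymptotically positive on $C$, meaning that its dominant term is positive on the interior of $C$. A finite Coxeter group here means a finite subgroup of the orthogonal group $O(d)$ generated by (orthogonal) reflections through linear hyperplanes; its Weyl chambers are the closures of the connected components of the complement in $\mathbb{R}^d$ of the union of all hyperplanes $F$ such that the reflection through $F$ belongs to the group. ''C is a Weyl chamber of a finite Coxeter group'' means that such a group exists having $C$ as one of its Weyl chambers. *)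

(* Defs.v *)
(* Only the structures of [mpoly] are imported,
   because its notations clash with those of MathComp-Analysis. *)
From HB Require Import structures.
From mathcomp Require Import all_boot all_order all_algebra finmap.
From mathcomp Require Import all_classical all_reals all_analysis.
From mathcomp Require mpoly.
Import (canonicals, coercions) mpoly.

Set Implicit Arguments.
Unset Strict Implicit.
Unset Printing Implicit Defensive.

Import Order.TTheory GRing.Theory Num.Theory.
Import numFieldNormedType.Exports.

Local Open Scope classical_set_scope.
Local Open Scope ring_scope.

Notation "{ 'mpoly' T [ n ] }" := (mpoly.mpoly n T)
  (at level 0, T at level 2, format "{ 'mpoly'  T [ n ] }") : type_scope.

Section Defs.
Variables (R : realType) (d : nat).
Implicit Types (u v x : 'cV[R]_d) (A : 'M[R]_d) (C D : set 'cV[R]_d).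

Definition orthant : set 'cV[R]_d := [set x | forall i, 0 <= x i 0].

Definition boundary C : set 'cV[R]_d := closure C `\` interior C.

Definition dot u v : R := \sum_i u i 0 * v i 0.

(* The norm that the library puts on matrices is the sup norm, hence the
   explicit Euclidean one. *)
Definition eucl_norm u : R := Num.sqrt (dot u u).

Definition vangle u v : R := acos (dot u v / (eucl_norm u * eucl_norm v)).

Definition discrete_laplacian (S : {fset 'cV[R]_d}) (a : 'cV[R]_d -> R)
    (f : 'cV[R]_d -> R) x : R :=
  (\sum_(s <- S) a s * f (x + s)) - f x.

Definition discrete_harmonic (S : {fset 'cV[R]_d}) (a : 'cV[R]_d -> R) D
    (f : 'cV[R]_d -> R) : Prop :=
  forall x, D x -> discrete_laplacian S a f x = 0.

Definition peval (P : {mpoly R[d]}) x : R := mpoly.meval (fun i => x i 0) P.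

(* [mmeasure _ mdeg P] is the total degree of [P] plus one when [P != 0];
   [pihomog] extracts a homogeneous component. *)
Definition dominant (P : {mpoly R[d]}) : {mpoly R[d]} :=
  mpoly.pihomog mpoly.mdeg (mpoly.mmeasure mpoly.mdeg P).-1 P.

Definition asymptotically_positive C (P : {mpoly R[d]}) : Prop :=
  forall x, interior C x -> 0 < peval (dominant P) x.

Definition aplus_polynomial (S : {fset 'cV[R]_d}) (a : 'cV[R]_d -> R) C
    (P : {mpoly R[d]}) : Prop :=
  [/\ P != 0,
      discrete_harmonic S a C (peval P),
      forall x, boundary C x -> peval P x = 0 &
      asymptotically_positive C P].

Definition hyperplane v : set 'cV[R]_d := [set x | dot v x = 0].

(* For [v != 0], the matrix of x |-> x - 2 <v, x> / <v, v> v, that is, of the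
   orthogonal reflection through [hyperplane v]. *)
Definition reflection_mx v : 'M[R]_d := 1%:M - (2 / dot v v) *: (v *m v^T).

Definition reflections : set 'M[R]_d :=
  [set A | exists2 v, v != 0 & A = reflection_mx v].

Definition orthogonal_group : set 'M[R]_d := [set A | A^T *m A = 1%:M].

Definition orthogonal_subgroup (G : set 'M[R]_d) : Prop :=
  [/\ G `<=` orthogonal_group,
      G 1%:M,
      forall A B, G A -> G B -> G (A *m B) &
      forall A, G A -> G (invmx A)].

Definition finite_coxeter_group (W : set 'M[R]_d) : Prop :=
  finite_set W /\
  exists2 T : set 'M[R]_d, T `<=` reflections &
    W = smallest orthogonal_subgroup T.

Definition mirrors (W : set 'M[R]_d) : set 'cV[R]_d :=
  [set x | exists v, [/\ v != 0, W (reflection_mx v) & hyperplane v x]].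

Definition weyl_chamber (W : set 'M[R]_d) C : Prop :=
  exists2 x, ~ mirrors W x &
    C = closure (connected_component (~` mirrors W) x).

Definition is_finite_coxeter_chamber C : Prop :=
  exists2 W : set 'M[R]_d, finite_coxeter_group W & weyl_chamber W C.

End Defs.

Arguments orthant : clear implicits.

(* Main.v *)
(* Let h be the dominant term of an a+-polynomial P. Since the walk has zero
   drift and identity covariance, the discrete Laplacian is half the Laplacian
   up to terms of degree at most deg - 3; hence h is a classical harmonic
   homogeneous polynomial that vanishes on the walls of C and is positive
   inside. By the reflection principle h changes sign under the reflections in
   the walls, so h w = det(w) h for all w in the group W they generate. Hence
   no mirror of W meets the interior of C, h vanishes on all mirrors, there
   are at most deg h of them, and W is finite: C is a chamber of W.

   Let Pi be the product of the linear forms of the N mirrors. It is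
   antiinvariant, and an antiinvariant polynomial of degree less than N
   vanishes; so Pi is harmonic. The product h Pi is nonnegative on C, hence
   everywhere, and not zero, so its Gaussian expectation is positive, whereas
   homogeneous harmonic polynomials of different degrees are orthogonal for
   the Gaussian measure. So deg h = N and h is proportional to Pi. Two
   a+-polynomials with the same dominant term differ by an element of degree
   less than N of the same kind, which is zero.

   For d = 2, with l1 l2 the product of the linear forms of the two walls, q
   |-> L(l1 l2 q) is an injective endomorphism of the polynomials of degree at
   most N - 3, hence bijective, and P = Pi + l1 l2 q for the q such that L(l1
   l2 q) = - L(Pi). In the plane, if the angle of C is pi / n then Im((x + i
   y)^n) is a harmonic polynomial vanishing on the walls and positive inside,
   which makes W finite as above; conversely all lines at angles k theta from
   a wall are mirrors, and the first one beyond the half-turn cannot enter C.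
   *)
Require Import Defs.
From HB Require Import structures.
From mathcomp Require Import all_boot all_order all_algebra finmap.
From mathcomp Require Import all_classical all_reals all_analysis.
From mathcomp Require Import ring lra zify.
From mathcomp Require mpoly.
From mathcomp.real_closed Require polyrcf.
Import -(notations) mpoly.

Set Implicit Arguments.
Unset Strict Implicit.
Unset Printing Implicit Defensive.

Import Order.TTheory GRing.Theory Num.Theory.
Import numFieldNormedType.Exports.

Local Open Scope classical_set_scope.
Local Open Scope ring_scope.

Local Notation MX i := (mpolyX _ (mnm1 i)).
Local Notation msize := (mmeasure mdeg).
Local Notation homog k := (ishomog1 k mdeg).

(** * Polynomial functions and the dot product *)

Section Evaluation.
Variables (R : realType) (n : nat).
Implicit Types (p q : {mpoly R[n]}) (x v : 'cV[R]_n).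

Lemma pevalD p q x : peval (p + q) x = peval p x + peval q x.
Proof. exact: mevalD. Qed.

Lemma pevalB p q x : peval (p - q) x = peval p x - peval q x.
Proof. exact: mevalB. Qed.

Lemma pevalM p q x : peval (p * q) x = peval p x * peval q x.
Proof. exact: mevalM. Qed.

Lemma pevalZ c p x : peval (c *: p) x = c * peval p x.
Proof. exact: mevalZ. Qed.

Lemma pevalC c x : peval (mpolyC n c) x = c.
Proof. exact: mevalC. Qed.

Lemma peval0 x : peval 0 x = 0.
Proof. exact: meval0. Qed.

Lemma pevalX i x : peval (MX i) x = x i 0.
Proof. exact: mevalXU. Qed.

Lemma peval_sum I (r : seq I) (P : pred I) (F : I -> {mpoly R[n]}) x :
  peval (\sum_(i <- r | P i) F i) x = \sum_(i <- r | P i) peval (F i) x.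
Proof.
by apply: (big_morph (fun p => peval p x)) => [p q|]; rewrite ?pevalD ?peval0.
Qed.

Lemma peval_prod I (r : seq I) (P : pred I) (F : I -> {mpoly R[n]}) x :
  peval (\prod_(i <- r | P i) F i) x = \prod_(i <- r | P i) peval (F i) x.
Proof.
apply: (big_morph (fun p => peval p x)) => [p q|]; first exact: pevalM.
exact: meval1.
Qed.

Lemma mpoly_ind_MXD (P : {mpoly R[n]} -> Prop) :
    (forall c, P (mpolyC n c)) -> (forall i p, P p -> P (MX i * p)) ->
    (forall p q, P p -> P q -> P (p + q)) ->
  forall p, P p.
Proof.
move=> PC PX PD.
have PM m p : P p -> P (mpolyX R m * p).
  rewrite mpolyXE_id; elim/big_ind: _ p => [p|u w IHu IHw p Pp|i _ p Pp].
  - by rewrite mul1r.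
  - by rewrite -mulrA; exact/IHu/IHw.
  - elim: (m i) => [|k IHk]; first by rewrite expr0 mul1r.
    by rewrite exprS -mulrA; exact: PX.
elim/mpolyind => [|c m p _ _ IH]; first by rewrite -mpolyC0.
by apply: PD => //; rewrite -mul_mpolyC mulrC; exact/PM/PC.
Qed.

Lemma mderivXU i j : mderiv i (MX j : {mpoly R[n]}) = (i == j)%:R.
Proof.
rewrite mderivX mnm1E eq_sym; case: eqP => [->|_]; last by rewrite scale0r.
by rewrite scale1r -mpolyX0; congr mpolyX; apply/mnmP => k; rewrite mnmBE subnn mnm0E.
Qed.

Lemma dotC x v : dot x v = dot v x.
Proof. by apply: eq_bigr => i _; rewrite mulrC. Qed.

Lemma dotDr v x y : dot v (x + y) = dot v x + dot v y.
Proof. by rewrite -big_split; apply: eq_bigr => i _; rewrite mxE mulrDr. Qed.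

Lemma dotZr v c x : dot v (c *: x) = c * dot v x.
Proof. by rewrite mulr_sumr; apply: eq_bigr => i _; rewrite mxE mulrCA. Qed.

Lemma dotNr v x : dot v (- x) = - dot v x.
Proof. by rewrite -scaleN1r dotZr mulN1r. Qed.

Lemma dotBr v x y : dot v (x - y) = dot v x - dot v y.
Proof. by rewrite dotDr dotNr. Qed.

Lemma dotDl x y v : dot (x + y) v = dot x v + dot y v.
Proof. by rewrite dotC dotDr !(dotC v). Qed.

Lemma dotZl v c x : dot (c *: x) v = c * dot x v.
Proof. by rewrite dotC dotZr (dotC v). Qed.

Lemma dotNl v x : dot (- x) v = - dot x v.
Proof. by rewrite dotC dotNr dotC. Qed.

Lemma dotBl x y v : dot (x - y) v = dot x v - dot y v.
Proof. by rewrite dotDl dotNl. Qed.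

Lemma dot0r v : dot v 0 = 0.
Proof. by rewrite -(scale0r 0) dotZr mul0r. Qed.

Lemma dotE v x : dot v x = (v^T *m x) 0 0.
Proof. by rewrite mxE; apply: eq_bigr => i _; rewrite mxE. Qed.

Lemma dot_mulmx (A : 'M[R]_n) v x : dot v (A *m x) = dot (A^T *m v) x.
Proof. by rewrite !dotE trmx_mul trmxK mulmxA. Qed.

Lemma dot_ge0 v : 0 <= dot v v.
Proof. by apply: sumr_ge0 => i _; rewrite -expr2 sqr_ge0. Qed.

Lemma dot_eq0 v : (dot v v == 0) = (v == 0).
Proof.
apply/eqP/eqP => [|->]; last exact: dot0r.
move/eqP; rewrite psumr_eq0 => [/allP h|i _]; last by rewrite -expr2 sqr_ge0.
apply/matrixP => i j; rewrite ord1 mxE.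
by have /eqP/eqP := h i (mem_index_enum _); rewrite mulf_eq0 orbb => /eqP.
Qed.

Lemma dot_gt0 v : v != 0 -> 0 < dot v v.
Proof. by rewrite -dot_eq0 lt0r dot_ge0 andbT. Qed.

Definition lform v : {mpoly R[n]} := \sum_i v i 0 *: MX i.

Lemma peval_lform v x : peval (lform v) x = dot v x.
Proof. by rewrite peval_sum; apply: eq_bigr => i _; rewrite pevalZ pevalX. Qed.

Lemma lform_homog v : lform v \is homog 1.
Proof.
apply: rpred_sum => i _; apply: rpredZ.
by rewrite dhomogX /= mdeg1.
Qed.

Lemma lform_neq0 v : v != 0 -> lform v != 0.
Proof.
rewrite -dot_eq0; apply: contraNneq => lv0.
by rewrite -peval_lform lv0 peval0.
Qed.

Lemma mderiv_lform i v : mderiv i (lform v) = mpolyC n (v i 0).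
Proof.
rewrite raddf_sum /= (bigD1 i) //= big1 ?addr0 => [|j ji].
  by rewrite mderivZ mderivXU eqxx -mul_mpolyC mulr1.
by rewrite mderivZ mderivXU eq_sym (negPf ji) scaler0.
Qed.

End Evaluation.

(** * Functionals of product type *)

Section UnivariateFunctional.
Variable R : realType.
Implicit Types (f : nat -> R) (q r : {poly R}).

(** The linear functional with value [f k] on ['X^k]: evaluation at [t] for the powers of [t],
    Gaussian expectation for [moment]. *)
Definition ulin f q : R := \sum_(k < size q) q`_k * f k.

Lemma ulinwE K f q : (size q <= K)%N -> ulin f q = \sum_(k < K) q`_k * f k.
Proof.
move=> qK; rewrite /ulin (big_ord_widen _ (fun k => q`_k * f k) qK) big_mkcond.
by apply: eq_bigr => k _; case: ltnP => // h; rewrite nth_default // mul0r.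
Qed.

Lemma ulinD f : {morph ulin f : q r / q + r}.
Proof.
move=> q r; pose K := maxn (size q) (size r).
rewrite (@ulinwE K f q) ?leq_maxl // (@ulinwE K f r) ?leq_maxr //.
rewrite (@ulinwE K f (q + r)) ?size_polyD // -big_split.
by apply: eq_bigr => k _; rewrite coefD mulrDl.
Qed.

Lemma ulinZ f c q : ulin f (c *: q) = c * ulin f q.
Proof.
rewrite (@ulinwE (size q)) ?size_scale_leq // mulr_sumr.
by apply: eq_bigr => k _; rewrite coefZ mulrA.
Qed.

Lemma ulin0 f : ulin f 0 = 0.
Proof. by rewrite /ulin size_poly0 big_ord0. Qed.

Lemma ulinXn f k : ulin f 'X^k = f k.
Proof.
rewrite (@ulinwE k.+1) ?size_polyXn // big_ord_recr /= big1 => [|j _].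
  by rewrite add0r coefXn eqxx mul1r.
by rewrite coefXn (ltn_eqF (ltn_ord j)) mul0r.
Qed.

Lemma ulinC f c : ulin f c%:P = c * f 0%N.
Proof. by rewrite -[c%:P]mulr1 mul_polyC ulinZ -(expr0 'X) ulinXn. Qed.

Lemma horner_ulin q t : ulin (fun k => t ^+ k) q = q.[t].
Proof. by rewrite horner_coef. Qed.

Lemma poly_eq0_horner q : (forall t, q.[t] = 0) -> q = 0.
Proof.
move=> q0; apply/eqP; apply: contraT => qn0.
have := max_poly_roots qn0 (rs := [seq k%:R | k <- iota 0 (size q)]).
rewrite size_map size_iota ltnn => /(_ _ _)/negP; case=> //.
  by apply/allP => t _; rewrite rootE q0.
rewrite map_inj_uniq ?iota_uniq // => a b /eqP; rewrite eqr_nat => /eqP //.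
Qed.

End UnivariateFunctional.

Section ProductFunctional.
Variables (R : realType) (n : nat).
Implicit Types (m : multinom n) (p q : {mpoly R[n]}) (x v : 'cV[R]_n) (phi : 'I_n -> nat -> R).

(* Evaluation at a point, extraction of a coefficient and Gaussian expectation
   are all of this form; one passes from one to another variable by variable. *)
Definition pfun phi p : R := \sum_(m <- msupp p) mcoeff m p * \prod_i phi i (m i).

Lemma pfunwE k phi p : (msize p <= k)%N ->
  pfun phi p = \sum_(m : bmultinom n k) mcoeff m p * \prod_i phi i (m i).
Proof.
move=> pk; rewrite /pfun; apply/esym.
rewrite (bigID (fun m : bmultinom n k => (m : multinom n) \in msupp p)) /= [X in _ + X]big1 ?addr0; last first.
  by move=> m /memN_msupp_eq0 ->; rewrite mul0r.
rewrite -[LHS]big_filter.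
rewrite -(big_map (fun m : bmultinom n k => m : multinom n) xpredT (fun m => mcoeff m p * \prod_i phi i (m i))).
apply: perm_big; apply: uniq_perm.
- by rewrite map_inj_uniq ?filter_uniq ?index_enum_uniq //; exact: val_inj.
- exact: msupp_uniq.
move=> m; apply/mapP/idP => [[b]|mp].
  by rewrite mem_filter => /andP[bp _] ->.
have mk : (mdeg m < k)%N by exact: leq_trans (msize_mdeg_lt mp) pk.
by exists (BMultinom mk) => //; rewrite mem_filter mem_index_enum andbT.
Qed.

Lemma pfunD phi p q : pfun phi (p + q) = pfun phi p + pfun phi q.
Proof.
pose k := maxn (msize p) (msize q).
rewrite (@pfunwE k _ (p + q)) ?(@pfunwE k _ p) ?(@pfunwE k _ q) ?leq_maxl ?leq_maxr ?msizeD_le //.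
by rewrite -big_split; apply: eq_bigr => m _; rewrite mcoeffD mulrDl.
Qed.

Lemma pfunZ c phi p : pfun phi (c *: p) = c * pfun phi p.
Proof.
rewrite (@pfunwE (msize p)) ?mmeasureZ_le // (@pfunwE (msize p)) // mulr_sumr.
by apply: eq_bigr => m _; rewrite mcoeffZ mulrA.
Qed.

Lemma pfun0 phi : pfun phi 0 = 0.
Proof. by rewrite -(scale0r 0) pfunZ mul0r. Qed.

Lemma pfun_sum phi I (r : seq I) (P : pred I) (F : I -> {mpoly R[n]}) :
  pfun phi (\sum_(i <- r | P i) F i) = \sum_(i <- r | P i) pfun phi (F i).
Proof. by apply: (big_morph (pfun phi)) => [p q|]; rewrite ?pfunD ?pfun0. Qed.

Lemma pfunX phi m : pfun phi (mpolyX R m) = \prod_i phi i (m i).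
Proof. by rewrite /pfun msuppX big_seq1 mcoeffX eqxx mul1r. Qed.

Lemma pfun_eval p x : pfun (fun i k => x i 0 ^+ k) p = peval p x.
Proof. by rewrite /peval mevalE. Qed.

Lemma pfun_coef p (m : multinom n) : pfun (fun i k => (m i == k)%:R) p = mcoeff m p.
Proof.
rewrite {1}(mpolyE p) pfun_sum [in RHS](mpolyE p) raddf_sum /=.
apply: eq_bigr => m' _; rewrite pfunZ mcoeffZ pfunX mcoeffX; congr (_ * _).
have [->|ne] := eqVneq m' m; first by rewrite big1 // => i _; rewrite eqxx.
have [i im] : exists i, m i != m' i.
  apply/existsP; rewrite -negb_forall; apply: contraNN ne => /forallP h.
  by apply/eqP/mnmP => i; rewrite (eqP (h i)).
by rewrite (bigD1 i) //= (negPf im) mul0r.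
Qed.

Definition upd phi (i : 'I_n) (f : nat -> R) (j : 'I_n) := if j == i then f else phi j.

(** Once the functionals of the other variables are applied, a univariate polynomial in the [i]-th
    variable remains, the same for all [f]. *)
Lemma pfun_slice phi i p :
  exists q : {poly R}, forall f, pfun (upd phi i f) p = ulin f q.
Proof.
pose c m := mcoeff m p * \prod_(j | j != i) phi j (m j).
exists (\sum_(m <- msupp p) c m *: 'X^(m i)) => f.
rewrite (big_morph (ulin f) (ulinD f) (ulin0 f)).
apply: eq_bigr => m _; rewrite ulinZ ulinXn /c (bigD1 i) //= /upd eqxx.
rewrite mulrCA mulrC; congr (_ * _ * _); apply: eq_bigr => j ji.
by rewrite (negPf ji).
Qed.

Lemma eq_pfun phi psi p : (forall i k, phi i k = psi i k) -> pfun phi p = pfun psi p.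
Proof. by move=> e; apply: eq_bigr => m _; congr (_ * _); apply: eq_bigr. Qed.

(** Interpolates between evaluation at [x] for [k = 0] and the functional with factors [f] for
    [k = n]. *)
Definition mixed (f : 'I_n -> nat -> R) (k : nat) x (i : 'I_n) : nat -> R :=
  if (i < k)%N then f i else fun j => x i 0 ^+ j.

Definition setcoord x (i : 'I_n) (t : R) : 'cV[R]_n := \col_j if j == i then t else x j 0.

Lemma mixed_upd f (k : 'I_n) x t i j :
  mixed f k (setcoord x k t) i j = upd (mixed f k x) k (fun j => t ^+ j) i j.
Proof.
rewrite /mixed /upd; case: ltnP => ik; last by rewrite mxE; case: eqP.
by case: eqP => // e; rewrite e ltnn in ik.
Qed.

Lemma mixed_succ f (k : 'I_n) x i j :
  mixed f k.+1 x i j = upd (mixed f k x) k (f k) i j.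
Proof.
rewrite /mixed /upd ltnS leq_eqVlt -(inj_eq val_inj).
by case: eqP => //= /val_inj->.
Qed.

(** Evaluation is exchanged for extraction of the coefficient of [m] one variable at a time: a slice
    that vanishes at every real is the zero polynomial, so every functional vanishes on it. *)
Lemma peval_eq0 p : (forall x, peval p x = 0) -> p = 0.
Proof.
move=> p0; apply/mpolyP => m; rewrite mcoeff0 -pfun_coef.
set f := fun _ _ => _.
have h k : (k <= n)%N -> forall x, pfun (mixed f k x) p = 0.
  elim: k => [_ x|k IHk kn x]; first by rewrite -[RHS](p0 x) -pfun_eval.
  rewrite (eq_pfun _ (mixed_succ f (Ordinal kn) x)).
  have [q hq] := pfun_slice (mixed f k x) (Ordinal kn) p.
  suff q0 : q = 0 by rewrite hq q0 ulin0.
  apply: poly_eq0_horner => t; rewrite -horner_ulin -hq.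
  rewrite -(IHk (ltnW kn) (setcoord x (Ordinal kn) t)).
  by apply: eq_pfun => i j; exact/esym/(mixed_upd f (Ordinal kn)).
rewrite -[RHS](h n (leqnn n) 0); apply: eq_pfun => i j.
by rewrite /mixed ltn_ord.
Qed.

Lemma peval_inj p q : (forall x, peval p x = peval q x) -> p = q.
Proof.
by move=> e; apply/eqP; rewrite -subr_eq0; apply/eqP/peval_eq0 => x; rewrite pevalB e subrr.
Qed.

End ProductFunctional.

(** * One-dimensional Gaussian moments *)

Section GaussianMoments.
Variable R : realType.
Implicit Types (p q r : {poly R}).

(** Moments of a standard Gaussian variable, by the recursion [E X^(k+1) = k E X^(k-1)]. *)
Fixpoint moment (k : nat) : R :=
  match k with
  | 0%N => 1
  | k'.+1 => match k' with 0%N => 0 | j.+1 => k'%:R * moment j end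
  end.

Lemma momentS k : moment k.+1 = k%:R * moment k.-1.
Proof. by case: k => [|k] //=; rewrite mul0r. Qed.

Arguments moment : simpl never.

Local Notation g := (ulin moment).

(** Integration by parts against the Gaussian density. *)
Lemma moment_mulX q : g (q * 'X) = g q^`().
Proof.
rewrite (@ulinwE _ (size q).+1); last first.
  by rewrite (leq_trans (size_polyMleq _ _)) // size_polyX addn2.
rewrite (@ulinwE _ (size q)) ?polyorder.size_deriv ?leq_pred //.
rewrite big_ord_recl coefMX /= mul0r add0r.
case E: (size q) => [|K]; first by rewrite !big_ord0.
rewrite big_ord_recl big_ord_recr /= coefMX /= mulr0 add0r.
rewrite coef_deriv nth_default ?E // mul0rn mul0r addr0.
apply: eq_bigr => k _; rewrite coefMX coef_deriv /bump !add1n /= momentS.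
by rewrite mulrA mulr_natr.
Qed.

(** Parseval's identity for Hermite polynomials: up to normalization, the expectation of the [k]-th
    derivative is the [k]-th Hermite coefficient. The induction takes a factor ['X] off [p] and
    integrates by parts. *)
Lemma moment_parseval K p q : (size p <= K)%N ->
  g (p * q) = \sum_(k < K) g p^`(k) * g q^`(k) / k`!%:R.
Proof.
elim: K p q => [|K IH] p q.
  by rewrite leqn0 size_poly_eq0 => /eqP->; rewrite mul0r ulin0 big_ord0.
elim/poly_ind: p => [|p c _] sp.
  rewrite mul0r ulin0 big1 // => k _.
  by rewrite derivn_poly0 ?size_poly0 // ulin0 !mul0r.
have {}sp : (size p <= K)%N.
  move: sp; rewrite size_MXaddC; case: ifP => [/andP[/eqP-> _] _|_]; last by [].
  by rewrite size_poly0.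
have nzfact k : k`!%:R != 0 :> R by rewrite pnatr_eq0 -lt0n fact_gt0.
have sp' : (size p^`() <= K)%N.
  by rewrite (leq_trans _ sp) // polyorder.size_deriv leq_pred.
rewrite mulrDl ulinD mulrAC moment_mulX derivM ulinD (IH p^`()) // (IH p) //.
rewrite (big_ord_recl K) !derivn0 ulinD moment_mulX ulinC mulr1 fact0 divr1.
pose T k := g p^`(k.+1) * g q^`(k) / k`!%:R.
have -> : \sum_(k < K) g (p^`())^`(k) * g q^`(k) / k`!%:R
    = g p^`() * g q + \sum_(k < K) T k.+1.
  transitivity (\sum_(k < K.+1) T k).
    rewrite big_ord_recr /= {2}/T derivn_poly0 ?(leq_trans sp) //.
    rewrite ulin0 !mul0r addr0; apply: eq_bigr => k _; by rewrite /T derivSn.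
  by rewrite big_ord_recl /T derivn1 derivn0 fact0 divr1.
set A := (X in _ + X + _).
have -> : \sum_(i < K) g (p * 'X + c%:P)^`(lift ord0 i) * g q^`(lift ord0 i) /
    (lift ord0 i)`!%:R = \sum_(k < K) T k.+1 + A; last by rewrite mul_polyC ulinZ; ring.
rewrite -big_split; apply: eq_bigr => k _.
rewrite [RHS]/= lift0 derivnMXaddC ulinD moment_mulX -derivnS /T -[p^`(k) *+ _]scaler_nat ulinZ.
rewrite -derivSn factS natrM.
have k1 : k.+1%:R != 0 :> R by rewrite pnatr_eq0.
by field; rewrite nzfact addrC natr1 k1.
Qed.

(** All terms of the Parseval sum are nonnegative, and the last one, whose index is the degree of
    [r], contains the nonzero leading coefficient. *)
Lemma moment_sqr_gt0 r : r != 0 -> 0 < g (r * r).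
Proof.
move=> r0; rewrite (moment_parseval _ (leqnn _)).
have pos (k : nat) : 0 <= g r^`(k) * g r^`(k) / k`!%:R :> R.
  by rewrite divr_ge0 ?ler0n // -expr2 sqr_ge0.
have [K sr] : exists K, size r = K.+1 by case: (size r) (size_poly_eq0 r) => [|K]; [rewrite (negPf r0) | exists K].
rewrite sr big_ord_recr /=; apply: ltr_wpDl; first by apply: sumr_ge0 => k _; exact: pos.
rewrite lt0r pos andbT mulf_neq0 ?invr_eq0 ?pnatr_eq0 -?lt0n ?fact_gt0 //.
suff h : g r^`(K) != 0 by rewrite mulf_neq0.
have -> : r^`(K) = (r`_K *+ K`!)%:P.
  apply/polyP => j; rewrite coef_derivn coefC; case: j => [|j].
    by rewrite addn0 ffactnn.
  by rewrite nth_default ?mul0rn // sr addnS ltnS leq_addr.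
rewrite ulinC mulr1 mulrn_eq0 negb_or -lt0n fact_gt0 /=.
by rewrite -[K]/(K.+1.-1) -sr -lead_coefE lead_coef_eq0.
Qed.

Lemma poly_ge0_closed q a :
  (forall e, 0 < e -> exists2 t, `|t - a| < e & 0 <= q.[t]) -> 0 <= q.[a].
Proof.
move=> h; rewrite leNgt; apply/negP => qa.
have [d d0 hd] := polyrcf.poly_cont a q (e := - q.[a]) ltac:(by rewrite oppr_gt0).
have [t ta qt] := h _ d0.
have := hd _ ta; rewrite ltr_norml => /andP[_]; lra.
Qed.

(** The leading coefficient of [q] is positive, and it is also that of [q - q.[0]], which is
    therefore positive from some point on. *)
Lemma poly_eventually_ge q : (forall t, 0 <= q.[t]) -> (1 < size q)%N ->
  exists M, forall t, M <= t -> q.[0] <= q.[t].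
Proof.
move=> q0 sq.
have lq : 0 < lead_coef q.
  rewrite lt_neqAle eq_sym lead_coef_eq0 -size_poly_gt0 (ltnW sq) /=.
  rewrite leNgt; apply/negP => lq.
  have [|M hM] := @polyrcf.poly_pinfty_gt_lc _ (- q); rewrite ?lead_coefN ?oppr_gt0 //.
  by have := hM M (lexx _); rewrite hornerN lead_coefN; have := q0 M; lra.
have sqc : (size (- q.[0]%:P)%R < size q)%N.
  by rewrite size_polyN (leq_ltn_trans (size_polyC_leq1 _)).
have [|M hM] := @polyrcf.poly_pinfty_gt_lc _ (q - q.[0]%:P); first by rewrite lead_coefDl.
exists M => t Mt; have := hM t Mt; rewrite lead_coefDl // hornerD hornerN hornerC; lra.
Qed.

Lemma poly_min q : (forall t, 0 <= q.[t]) -> exists a, forall t, q.[a] <= q.[t].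
Proof.
move=> q0; have [sq|sq] := leqP (size q) 1.
  by exists 0 => t; rewrite (size1_polyC sq) !hornerC.
have [M1 h1] := poly_eventually_ge q0 sq.
(* Composition with [- 'X] gives the bound towards minus infinity. *)
have [t||M2 h2] := @poly_eventually_ge (q \Po (- 'X)) _ _.
- by rewrite horner_comp.
- by rewrite size_comp_poly2 // size_polyN size_polyX.
pose M := Num.max 0 (Num.max M1 M2).
have M0 : 0 <= M by rewrite le_max lexx.
have [||a _ ha] := @EVT_min R (horner q) (- M) M.
  by rewrite lerNl (le_trans _ M0) ?oppr_le0.
  by apply: continuous_subspaceT => x; exact: continuous_horner.
have a0 : q.[a] <= q.[0] by apply: ha; rewrite in_itv /= oppr_le0 M0.
exists a => t; have [tM|Mt] := leP `|t| M.
  by apply: ha; rewrite in_itv /= -ler_norml.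
apply: le_trans a0 _; have [t0|t0] := leP 0 t.
  by apply: h1; rewrite ger0_norm // in Mt; apply: le_trans (ltW Mt); rewrite !le_max lexx !orbT.
have := h2 (- t); rewrite !horner_comp !hornerE oppr0 opprK; apply.
by rewrite ltr0_norm // in Mt; apply: le_trans (ltW Mt); rewrite !le_max lexx !orbT.
Qed.

(** At a minimum [a], the nonnegative polynomial [q - q.[a]] has a root that must be at least
    double; the quotient by the square is nonnegative off [a], and at [a] by continuity. *)
Lemma poly_nneg_split q : (forall t, 0 <= q.[t]) -> (1 < size q)%N ->
  exists c a s, [/\ 0 <= c, q = c%:P + ('X - a%:P) ^+ 2 * s,
    forall t, 0 <= s.[t] & (size s < size q)%N].
Proof.
move=> q0 sq; have [a ha] := poly_min q0.
have /factor_theorem[s1 hs1] : root (q - q.[a]%:P) a by rewrite rootE !hornerE subrr.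
have E1 t : q.[t] - q.[a] = s1.[t] * (t - a).
  by have := congr1 (horner^~ t) hs1; rewrite !hornerE.
have hd (e : R) : 0 < e -> [/\ `|a + e / 2 - a| < e, `|a - e / 2 - a| < e & 0 < e / 2].
  by move=> e0; split; rewrite ?ltr_norml; try (apply/andP; split); lra.
have s1a : root s1 a.
  rewrite rootE eq_le; apply/andP; split.
    rewrite -oppr_ge0 -hornerN; apply: poly_ge0_closed => e /hd[_ he e0].
    exists (a - e / 2) => //; rewrite hornerN.
    have := ha (a - e / 2); have := E1 (a - e / 2); nra.
  apply: poly_ge0_closed => e /hd[he _ e0].
  exists (a + e / 2) => //; have := ha (a + e / 2); have := E1 (a + e / 2); nra.
have /factor_theorem[s hs] := s1a.
have E2 t : q.[t] - q.[a] = s.[t] * (t - a) ^+ 2.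
  by rewrite E1 hs !hornerM !hornerXsubC -mulrA -expr2.
have s0 t : t != a -> 0 <= s.[t].
  move=> ta; have : 0 < (t - a) ^+ 2 by rewrite exprn_even_gt0 //= subr_eq0.
  by move/pmulr_lge0 => <-; rewrite -E2 subr_ge0.
exists q.[a], a, s; split => //.
- by rewrite -[LHS](subrK q.[a]%:P) hs1 hs; ring.
- move=> t; have [->|] := eqVneq t a; last exact: s0.
  apply: poly_ge0_closed => e /hd[he _ e0]; exists (a + e / 2) => //.
  by apply: s0; rewrite -subr_eq0 addrAC subrr add0r gt_eqF.
have [->|sn0] := eqVneq s 0; first by rewrite size_poly0 (ltnW sq).
have qE : q = s * ('X - a%:P) ^+ 2 + q.[a]%:P.
  by rewrite -[LHS](subrK q.[a]%:P) hs1 hs; ring.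
have sX : size (s * ('X - a%:P) ^+ 2) = (size s).+2.
  rewrite size_Mmonic ?monic_exp ?monicXsubC // size_exp_XsubC addn3 //.
by rewrite qE size_polyDl sX // (leq_ltn_trans (size_polyC_leq1 _)).
Qed.

Lemma moment_gt0 q : (forall t, 0 <= q.[t]) -> q != 0 -> 0 < g q.
Proof.
(* The square [r * r] strengthens the induction: it absorbs the factor [('X - a%:P) ^+ 2] that
   [poly_nneg_split] produces. *)
suff h k r : (forall t, 0 <= q.[t]) -> (size q <= k)%N -> q != 0 -> r != 0 -> 0 < g (r * r * q).
  by move=> q0 qn0; have := h _ 1 q0 (leqnn _) qn0 (oner_neq0 _); rewrite !mul1r.
elim: k q r => [|k IH] q r q0 sq qn0 rn0.
  by move: sq qn0; rewrite leqn0 size_poly_eq0 => ->.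
have [s1|s1] := leqP (size q) 1.
  rewrite (size1_polyC s1) mulrC mul_polyC ulinZ mulr_gt0 ?moment_sqr_gt0 //.
  have := q0 0; rewrite le_eqVlt {2}(size1_polyC s1) hornerC => /orP[/eqP h|//].
  by move: qn0; rewrite (size1_polyC s1) in h *; rewrite hornerC in h; rewrite -h eqxx.
have [c [a [s [c0 qE s0 ss]]]] := poly_nneg_split q0 s1.
have -> : r * r * q =
  c *: (r * r) + (r * ('X - a%:P)) * (r * ('X - a%:P)) * s by rewrite qE -mul_polyC; ring.
rewrite ulinD ulinZ ltr_wpDl ?mulr_ge0 ?(ltW (moment_sqr_gt0 _)) //; apply: IH => //.
- by rewrite -ltnS (leq_trans ss).
- apply: contraTneq s1 => s_0; rewrite qE s_0 mulr0 addr0 -leqNgt; exact: size_polyC_leq1.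
- by rewrite mulf_neq0 // polyXsubC_eq0.
Qed.

Lemma moment_nneg q : (forall t, 0 <= q.[t]) -> 0 <= g q.
Proof. by have [->|qn0 q0] := eqVneq q 0; rewrite ?ulin0 // ltW ?moment_gt0. Qed.

End GaussianMoments.

(** * Gaussian expectation and harmonic polynomials *)

Section Gaussian.
Variables (R : realType) (n : nat).
Implicit Types (m : multinom n) (p q : {mpoly R[n]}) (x v : 'cV[R]_n).

Definition gauss p : R := pfun (fun _ => moment R) p.

(** Gaussian integration by parts; on monomials it is the recursion [momentS] in the [i]-th
    variable. *)
Lemma gauss_ibp i p : gauss (MX i * p) = gauss (mderiv i p).
Proof.
elim/mpolyind: p => [|c m p _ _ IH]; first by rewrite mulr0 mderiv0 /gauss !pfun0.
rewrite mulrDr mderivD /gauss !pfunD -!/(gauss _) IH; congr (_ + _).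
rewrite -scalerAr mderivZ /gauss !pfunZ mderivX pfunZ -mpolyXD !pfunX; congr (_ * _).
rewrite (bigD1 i) // [in RHS](bigD1 i) //= mnmDE mnmBE mnm1E eqxx.
rewrite add1n subn1 momentS -mulrA; congr (_ * (_ * _)); apply: eq_bigr => j ji.
by rewrite mnmDE mnmBE mnm1E eq_sym (negPf ji) add0n subn0.
Qed.

Lemma gauss_gt0 p : (forall x, 0 <= peval p x) -> p != 0 -> 0 < gauss p.
Proof.
move=> p0 pn0; pose f (_ : 'I_n) := moment R.
(* The variables are integrated out one at a time, which keeps a function that is nonnegative
   everywhere and positive somewhere. *)
have {p0 pn0} h k : (k <= n)%N -> (forall x, 0 <= pfun (mixed f k x) p) /\
    exists x, 0 < pfun (mixed f k x) p.
  elim: k => [_|k IHk kn].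
    have e x : pfun (mixed f 0 x) p = peval p x by rewrite -pfun_eval.
    split=> [x|]; first by rewrite e.
    apply: contrapT => h; move/eqP: pn0; apply; apply: peval_eq0 => x.
    apply/eqP; rewrite eq_le p0 andbT leNgt -e; apply/negP => px.
    by apply: h; exists x.
  have [h0 [x xp]] := IHk (ltnW kn).
  have slice y : exists2 q : {poly R}, pfun (mixed f k.+1 y) p = ulin (moment R) q &
      forall t, q.[t] = pfun (mixed f k (setcoord y (Ordinal kn) t)) p.
    have [q hq] := pfun_slice (mixed f k y) (Ordinal kn) p; exists q.
      by rewrite (eq_pfun _ (mixed_succ f (Ordinal kn) y)) hq.
    move=> t; rewrite -horner_ulin -hq.
    by apply: eq_pfun => i j; exact/esym/(mixed_upd f (Ordinal kn)).
  split=> [y|]; first by have [q -> hq] := slice y; apply: moment_nneg => t; rewrite hq.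
  exists x; have [q -> hq] := slice x; apply: moment_gt0 => [t|]; first by rewrite hq.
  apply: contraTneq xp => q0; have := hq (x (Ordinal kn) 0).
  rewrite q0 horner0 -leNgt => /esym; suff -> : setcoord x (Ordinal kn) (x (Ordinal kn) 0) = x by move->.
  by apply/matrixP => i j; rewrite ord1 mxE; case: eqP => // ->.
have [_ [x]] := h n (leqnn n); rewrite /gauss; congr (0 < _).
by apply: eq_pfun => i j; rewrite /mixed ltn_ord.
Qed.

Definition lap p : {mpoly R[n]} := \sum_i mderiv i (mderiv i p).

Lemma lapD p q : lap (p + q) = lap p + lap q.
Proof. by rewrite -big_split; apply: eq_bigr => i _; rewrite !mderivD. Qed.

Lemma lapZ c p : lap (c *: p) = c *: lap p.
Proof. by rewrite scaler_sumr; apply: eq_bigr => i _; rewrite !mderivZ. Qed.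

Lemma lapB p q : lap (p - q) = lap p - lap q.
Proof. by rewrite lapD -scaleN1r lapZ scaleN1r. Qed.

Lemma homogP k p : p \is homog k -> forall m, mcoeff m p != 0 -> mdeg m = k.
Proof. by move=> /dhomogP h m mp; apply: h; rewrite mcoeff_msupp. Qed.

Lemma mderiv_homog k i p : p \is homog k -> mderiv i p \is homog k.-1.
Proof.
move=> /homogP h; apply/dhomogP => m; rewrite mcoeff_msupp mcoeff_deriv mulrn_eq0 /= => mi.
by rewrite /= -(h _ mi) mdegD mdeg1 addn1.
Qed.

Lemma lap_homog k p : p \is homog k -> lap p \is homog k.-2.
Proof. by move=> h; apply: rpred_sum => i _; do 2!apply: mderiv_homog. Qed.

Lemma euler_homog k p : p \is homog k -> \sum_i MX i * mderiv i p = k%:R *: p.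
Proof.
move=> /homogP h; rewrite [in RHS](mpolyE p) scaler_sumr.
transitivity (\sum_i \sum_(m <- msupp p) mcoeff m p *: ((m i)%:R *: mpolyX R m)).
  apply: eq_bigr => i _; rewrite {1}(mpolyE p) raddf_sum mulr_sumr /=.
  apply: eq_bigr => m _; rewrite mderivZ mderivX -!scalerAr -mpolyXD.
  (* For [m i = 0] the subtraction of exponents is truncated, but the coefficient is zero. *)
  have [->|mi] := eqVneq (m i) 0%N; first by rewrite !scale0r.
  by rewrite addmC submK // lep1mP.
rewrite exchange_big /= !big_seq; apply: eq_bigr => m; rewrite mcoeff_msupp => mp.
by rewrite -scaler_sumr -scaler_suml -natr_sum -mdegE (h _ mp) !scalerA mulrC.
Qed.

(* Integrating by parts, [k%:R * gauss (p * q)] is the expectation of the inner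
   product of the gradients, which is symmetric in [p] and [q]. *)
Lemma gauss_harmonic_ortho k l p q : p \is homog k -> q \is homog l ->
  lap p = 0 -> lap q = 0 -> k != l -> gauss (p * q) = 0.
Proof.
have gsum I (r : seq I) F : gauss (\sum_(i <- r) F i) = \sum_(i <- r) gauss (F i).
  exact: pfun_sum.
have key k' p' q' : p' \is homog k' -> lap p' = 0 ->
    k'%:R * gauss (p' * q') = \sum_i gauss (mderiv i p' * mderiv i q').
  move=> hp lp; rewrite -[LHS]pfunZ scalerAl -(euler_homog hp) mulr_suml -/(gauss _) gsum.
  transitivity (\sum_i (gauss (mderiv i (mderiv i p') * q') + gauss (mderiv i p' * mderiv i q'))).
    by apply: eq_bigr => i _; rewrite -mulrA [LHS]gauss_ibp mderivM /gauss pfunD.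
  by rewrite big_split /= -gsum -mulr_suml -/(lap _) lp mul0r /gauss pfun0 add0r.
move=> hp hq lp lq kl; have e1 := key _ _ q hp lp; have e2 := key _ _ p hq lq.
have : (k%:R - l%:R) * gauss (p * q) = 0.
  rewrite mulrBl e1 [p * q]mulrC e2 [X in X - _ = _](_ : _ = \sum_i gauss (mderiv i q * mderiv i p)) ?subrr //.
  by apply: eq_bigr => i _; rewrite mulrC.
by move/eqP; rewrite mulf_eq0 subr_eq0 eqr_nat (negPf kl) => /eqP.
Qed.

End Gaussian.

(** * Reflections *)

Section Reflections.
Variables (R : realType) (n : nat).
Implicit Types (p q : {mpoly R[n]}) (u v w x y : 'cV[R]_n) (A B : 'M[R]_n).

Lemma orthogonal_tr A : orthogonal_group A -> A *m A^T = 1%:M.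
Proof. exact: mulmx1C. Qed.

Lemma orthogonal_unit A : orthogonal_group A -> A \in unitmx.
Proof. by move=> /mulmx1_unit[]. Qed.

Lemma orthogonal_inv A : orthogonal_group A -> invmx A = A^T.
Proof.
move=> oA; rewrite -[LHS]mul1mx -[X in X *m _]oA -mulmxA mulmxV ?mulmx1 //.
exact: orthogonal_unit.
Qed.

Lemma orthogonal_trmx A : orthogonal_group A -> orthogonal_group A^T.
Proof. by move=> oA; rewrite /orthogonal_group /= trmxK orthogonal_tr. Qed.

Lemma orthogonal_dot A x y : orthogonal_group A -> dot (A *m x) (A *m y) = dot x y.
Proof. by move=> oA; rewrite dot_mulmx mulmxA oA mul1mx. Qed.

Lemma orthogonal_dotl A x y : orthogonal_group A -> dot x (A *m y) = dot (A^T *m x) y.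
Proof. by move=> oA; rewrite dot_mulmx. Qed.

Lemma mulmx_outer u v x : u *m v^T *m x = dot v x *: u.
Proof.
rewrite -mulmxA; apply/matrixP => i j; rewrite ord1 !mxE big_ord1 mulrC.
by rewrite dotE.
Qed.

Lemma reflection_mulmx v x :
  reflection_mx v *m x = x - (2 / dot v v * dot v x) *: v.
Proof. by rewrite mulmxBl mul1mx -scalemxAl mulmx_outer scalerA. Qed.

Lemma eq_mulmx A B : (forall x, A *m x = B *m x) -> A = B.
Proof.
move=> e; apply/matrixP => i j; have := congr1 (fun M : 'cV[R]_n => M i 0) (e (delta_mx j 0)).
by rewrite -!colE !mxE.
Qed.

Lemma reflection_sym v : (reflection_mx v)^T = reflection_mx v.
Proof. by rewrite /reflection_mx linearB linearZ /= trmx1 trmx_mul trmxK. Qed.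

Lemma reflection_invol v : v != 0 -> reflection_mx v *m reflection_mx v = 1%:M.
Proof.
move=> v0; apply: eq_mulmx => x; rewrite mul1mx -mulmxA !reflection_mulmx dotBr dotZr.
have vv : dot v v != 0 by rewrite dot_eq0.
rewrite -addrA -opprD -scalerDl [X in X *: _](_ : _ = 0) ?scale0r ?subr0 //.
by field.
Qed.

Lemma reflection_orthogonal v : v != 0 -> orthogonal_group (reflection_mx v).
Proof. by move=> v0; rewrite /orthogonal_group /= reflection_sym reflection_invol. Qed.

Lemma reflection_fixed v x : v != 0 -> (reflection_mx v *m x == x) = (dot v x == 0).
Proof.
move=> v0; rewrite reflection_mulmx -subr_eq0 addrAC subrr add0r oppr_eq0.
by rewrite scaler_eq0 (negPf v0) orbF !mulf_eq0 invr_eq0 dot_eq0 (negPf v0) pnatr_eq0.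
Qed.

Lemma reflection_self v : v != 0 -> reflection_mx v *m v = - v.
Proof.
move=> v0; rewrite reflection_mulmx divfK ?dot_eq0 //.
by rewrite scaler_nat mulr2n opprD addrA subrr add0r.
Qed.

Lemma reflection_scale c v : c != 0 -> reflection_mx (c *: v) = reflection_mx v.
Proof.
move=> c0; apply: eq_mulmx => x; rewrite !reflection_mulmx !(dotZl, dotZr) scalerA.
have [->|v0] := eqVneq v 0; first by rewrite !scaler0.
congr (_ - _ *: _); have vv : dot v v != 0 by rewrite dot_eq0.
by field; rewrite vv.
Qed.

Lemma reflection_conj A v : orthogonal_group A ->
  A *m reflection_mx v *m A^T = reflection_mx (A *m v).
Proof.
move=> oA; apply: eq_mulmx => x; rewrite -!mulmxA !reflection_mulmx orthogonal_dot //.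
rewrite mulmxBr mulmxA orthogonal_tr // mul1mx -scalemxAr; congr (_ - (_ * _) *: _).
by rewrite dot_mulmx trmxK.
Qed.

(** A reflection negates only the multiples of its normal, and [u] is negated by both. *)
Lemma reflection_parallel u v : u != 0 -> v != 0 ->
  reflection_mx u = reflection_mx v -> exists2 c, c != 0 & u = c *: v.
Proof.
move=> u0 v0 e; have := reflection_self u0; rewrite e reflection_mulmx => h.
exists (dot v u / dot v v).
  rewrite mulf_neq0 ?invr_eq0 ?dot_eq0 //; apply: contra_neqN u0 => /eqP vu.
  move: h; rewrite vu mulr0 scale0r subr0 => /eqP.
  by rewrite -addr_eq0 -mulr2n -scaler_nat scaler_eq0 pnatr_eq0 => /eqP.
have e2 : 2%:R *: u = 2%:R *: ((dot v u / dot v v) *: v).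
  rewrite scaler_nat mulr2n -{2}[u]opprK -h opprB addrC subrK scalerA.
  by congr (_ *: _); ring.
by apply: scalerI e2; rewrite pnatr_eq0.
Qed.

(** The reflection along [v - u] exchanges two vectors of equal length. *)
Lemma householder u v : dot u u = dot v v -> exists2 A, orthogonal_group A & A *m u = v.
Proof.
move=> uv; have [->|w0] := eqVneq u v.
  by exists 1%:M; rewrite /orthogonal_group /= ?trmx1 mul1mx.
have {w0} w0 : v - u != 0 by rewrite subr_eq0 eq_sym.
exists (reflection_mx (v - u)); first exact: reflection_orthogonal.
have w1 : dot (v - u) (v - u) != 0 by rewrite dot_eq0.
have e : dot (v - u) (v - u) = - 2 * dot (v - u) u.
  by rewrite !(dotBl, dotBr) uv (dotC u v); ring.
suff c1 : 2 / dot (v - u) (v - u) * dot (v - u) u = -1.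
  by rewrite reflection_mulmx c1 scaleN1r opprK addrC subrK.
by apply: (mulfI w1); rewrite mulrAC mulrC divfK // mulrN1 e; ring.
Qed.

Lemma dot_delta i x : dot (delta_mx i 0) x = x i 0.
Proof.
rewrite /dot (bigD1 i) //= big1 => [|j ji].
  by rewrite mxE !eqxx mul1r addr0.
by rewrite mxE (negPf ji) mul0r.
Qed.

Lemma reflection_delta i x j :
  (reflection_mx (delta_mx i 0) *m x) j 0 = if j == i then - x i 0 else x j 0.
Proof.
rewrite reflection_mulmx !mxE !dot_delta mxE !eqxx divr1 andbT.
by case: eqP => [->|_]; rewrite ?mulr1 ?mulr0 ?subr0 //; ring.
Qed.

(** Reduces statements on an arbitrary mirror to a coordinate hyperplane. *)
Lemma rotate_to_axis v i : v != 0 ->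
  exists A, [/\ orthogonal_group A, A *m reflection_mx v *m A^T = reflection_mx (delta_mx i 0)
    & exists2 c, c != 0 & A *m v = c *: delta_mx i 0].
Proof.
move=> v0; pose c := Num.sqrt (dot v v).
have c0 : c != 0 by rewrite sqrtr_eq0 -ltNge dot_gt0.
have [|A oA Av] := @householder v (c *: delta_mx i 0).
  by rewrite dotZl dotZr dot_delta mxE !eqxx mulr1 -expr2 sqr_sqrtr // dot_ge0.
by exists A; split=> //; [rewrite reflection_conj // Av reflection_scale | exists c].
Qed.

Lemma cV_neq0 v : v != 0 -> exists i, v i 0 != 0.
Proof.
move=> v0; apply/existsP; rewrite -negb_forall; apply: contraNN v0 => /forallP h.
by apply/eqP/matrixP => i j; rewrite ord1 mxE; exact/eqP/h.
Qed.

Lemma reflection_det v : v != 0 -> \det (reflection_mx v) = -1.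
Proof.
move=> v0; have [i _] := cV_neq0 v0; have [A [oA e _]] := rotate_to_axis i v0.
have dA : \det A * \det A = 1 by rewrite -{2}det_tr -det_mulmx orthogonal_tr // det1.
have : \det (A *m reflection_mx v *m A^T) = \det (reflection_mx v).
  by rewrite !det_mulmx det_tr mulrAC dA mul1r.
rewrite e => <-.
have -> : reflection_mx (delta_mx i 0) = diag_mx (\row_(j < n) (if j == i then - (1 : R) else 1)).
  apply: eq_mulmx => x; apply/matrixP => j k; rewrite ord1 reflection_delta mul_diag_mx !mxE.
  by case: eqP => [->|_]; rewrite ?mulN1r ?mul1r.
rewrite det_diag (bigD1 i) //= mxE eqxx big1 ?mulr1 // => j ji.
by rewrite mxE (negPf ji).
Qed.

End Reflections.

(** * Orthogonal substitutions and the reflection principle *)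

Section Substitution.
Variables (R : realType) (n : nat).
Implicit Types (m : multinom n) (p q : {mpoly R[n]}) (u v w x y : 'cV[R]_n) (A B : 'M[R]_n).

Definition lsub A p : {mpoly R[n]} :=
  comp_mpoly [tuple \sum_j A i j *: MX j | i < n] p.

Lemma peval_lsub A p x : peval (lsub A p) x = peval p (A *m x).
Proof.
rewrite /peval comp_mpoly_meval; apply: meval_eq => i.
rewrite tnth_mktuple -/(peval _ x) peval_sum mxE.
by apply: eq_bigr => j _; rewrite pevalZ pevalX.
Qed.

Lemma lsubD A p q : lsub A (p + q) = lsub A p + lsub A q.
Proof. exact: comp_mpolyD. Qed.

Lemma lsub_sum A I (r : seq I) (F : I -> {mpoly R[n]}) :
  lsub A (\sum_(i <- r) F i) = \sum_(i <- r) lsub A (F i).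
Proof. exact: raddf_sum. Qed.

Lemma mderiv_lsub A p k : mderiv k (lsub A p) = \sum_i A i k *: lsub A (mderiv i p).
Proof.
have lM q r : lsub A (q * r) = lsub A q * lsub A r.
  by apply: peval_inj => x; rewrite pevalM !peval_lsub pevalM.
elim/mpoly_ind_MXD: p => [c|j p IH|p q IHp IHq].
- rewrite /lsub comp_mpolyC mderivC big1 // => i _.
  by rewrite mderivC comp_mpoly0 scaler0.
- have lX : lsub A (MX j) = \sum_l A j l *: MX l.
    apply: peval_inj => x; rewrite peval_lsub pevalX peval_sum mxE.
    by apply: eq_bigr => l _; rewrite pevalZ pevalX.
  have dX : mderiv k (lsub A (MX j)) = mpolyC n (A j k).
    rewrite lX raddf_sum /= (bigD1 k) //= big1 ?addr0 => [|l lk].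
      by rewrite mderivZ mderivXU eqxx -mul_mpolyC mulr1.
    by rewrite mderivZ mderivXU eq_sym (negPf lk) scaler0.
  rewrite lM mderivM dX IH mul_mpolyC mulr_sumr.
  transitivity (\sum_i (A i k *: ((i == j)%:R * lsub A p) + A i k *: (lsub A (MX j) * lsub A (mderiv i p)))).
    rewrite big_split /= [X in _ = X + _](bigD1 j) //= eqxx mul1r [X in _ = _ + X + _]big1 ?addr0 => [|i ij].
      by congr (_ + _); apply: eq_bigr => i _; rewrite scalerAr.
    by rewrite (negPf ij) mul0r scaler0.
  apply: eq_bigr => i _; rewrite mderivM lsubD !lM scalerDr mderivXU; congr (_ *: (_ * _) + _).
  by case: (i == j); rewrite /lsub ?mulr1n ?comp_mpoly1 ?mulr0n ?comp_mpoly0.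
rewrite lsubD mderivD IHp IHq -big_split; apply: eq_bigr => i _.
by rewrite mderivD lsubD scalerDr.
Qed.

(** By the chain rule, the second derivatives appear with the entries of [A *m A^T] as coefficients,
    that is, of the identity. *)
Lemma lap_lsub A p : orthogonal_group A -> lap (lsub A p) = lsub A (lap p).
Proof.
move=> /orthogonal_tr oA.
transitivity (\sum_k \sum_i \sum_j (A i k * A j k) *: lsub A (mderiv j (mderiv i p))).
  apply: eq_bigr => k _; rewrite mderiv_lsub raddf_sum /=; apply: eq_bigr => i _.
  by rewrite mderivZ mderiv_lsub scaler_sumr; apply: eq_bigr => j _; rewrite scalerA.
rewrite exchange_big /= lsub_sum; apply: eq_bigr => i _.
rewrite exchange_big /= (bigD1 i) //= [X in _ + X]big1 ?addr0 => [|j ji].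
  rewrite -scaler_suml [X in X *: _](_ : _ = 1) ?scale1r //.
  have := congr1 (fun M : 'M[R]_n => M i i) oA; rewrite !mxE eqxx mulr1n => <-.
  by apply: eq_bigr => k _; rewrite mxE.
rewrite -scaler_suml [X in X *: _](_ : _ = 0) ?scale0r //.
have := congr1 (fun M : 'M[R]_n => M i j) oA; rewrite !mxE eq_sym (negPf ji) mulr0n => h0; rewrite -[RHS]h0.
by apply: eq_bigr => k _; rewrite mxE.
Qed.

(** The monomials free of the [i]-th variable add up to [q1], whose value at [x] is that of [q] at
    the projection of [x] to the hyperplane; so [q1] is zero. *)
Lemma hyperplane_coef i q : (forall x, x i 0 = 0 -> peval q x = 0) ->
  forall m, m i = 0%N -> mcoeff m q = 0.
Proof.
move=> hq m mi; pose q1 := \sum_(m' <- msupp q | m' i == 0%N) mcoeff m' q *: mpolyX R m'.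
have {hq} q10 : q1 = 0.
  apply: peval_eq0 => x; rewrite -(hq (setcoord x i 0)); last by rewrite mxE eqxx.
  rewrite [in RHS](mpolyE q) !peval_sum [RHS](bigID (fun m' : multinom n => m' i == 0%N)) /=.
  rewrite [X in _ = _ + X]big1 ?addr0 => [|m' m'i]; last first.
    rewrite pevalZ [peval _ _]mevalX (bigD1 i) //= mxE eqxx expr0n (negPf m'i) mul0r.
    by rewrite mulr0.
  apply: eq_bigr => m' /eqP m'i; rewrite !pevalZ /peval !mevalX; congr (_ * _).
  by apply: eq_bigr => j _; rewrite mxE; case: eqP => // ->; rewrite m'i !expr0.
rewrite -[RHS](mcoeff0 R m) -q10 {1}(mpolyE q) !raddf_sum /= [RHS]big_mkcond /=.
apply: eq_bigr => m' _; rewrite !mcoeffZ !mcoeffX.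
by case: (eqVneq m' m) => [->|_]; rewrite ?mi ?eqxx // mulr0; case: ifP.
Qed.

(* The coefficients of [lap q] express those of [q] of degree [k.+2] in the
   [i]-th variable through those of degree [k]. *)
Lemma harmonic_odd i q : lap q = 0 -> (forall x, x i 0 = 0 -> peval q x = 0) ->
  forall m, ~~ odd (m i) -> mcoeff m q = 0.
Proof.
move=> lq hq m mi; have [k mk] : exists k, m i = k.*2.
  by exists (m i)./2; rewrite even_halfK.
elim: k m {mi} mk => [|k IH] m mk; first exact: (hyperplane_coef hq).
pose m' := mnm_sub (mnm_sub m (mnm1 i)) (mnm1 i).
have mE : mnm_add (mnm_add m' (mnm1 i)) (mnm1 i) = m.
  apply/mnmP => j; rewrite !mnmDE !mnmBE !mnm1E.
  by case: eqP => [<-|_]; rewrite ?subn0 ?addn0 // mk doubleS !subn1 !addn1.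
have m'i : m' i = k.*2 by rewrite !mnmBE !mnm1E eqxx mk doubleS !subn1.
have := congr1 (mcoeff m') lq; rewrite raddf_sum mcoeff0 /= (bigD1 i) //=.
rewrite big1 => [|j ji]; last first.
  rewrite !mcoeff_deriv IH ?mul0rn //.
  by rewrite !mnmDE !mnm1E (negPf ji) !addn0.
by rewrite addr0 !mcoeff_deriv mE => /eqP; rewrite !mulrn_eq0 /= => /eqP.
Qed.

(** Schwarz's reflection principle: after an orthogonal change of variables the mirror is a
    coordinate hyperplane, and [harmonic_odd] leaves only monomials of odd degree in the coordinate
    that changes sign. *)
Lemma harmonic_reflection v p : v != 0 -> lap p = 0 ->
  (forall x, dot v x = 0 -> peval p x = 0) ->
  forall x, peval p (reflection_mx v *m x) = - peval p x.
Proof.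
move=> v0 lp hp x; have [i _] := cV_neq0 v0.
have [A [oA Ar [c c0 Av]]] := rotate_to_axis i v0.
pose q := lsub A^T p.
have lq : lap q = 0 by rewrite lap_lsub ?lp ?[lsub _ _]raddf0 //; exact: orthogonal_trmx.
have hq y : y i 0 = 0 -> peval q y = 0.
  move=> yi; rewrite peval_lsub hp // dot_mulmx trmxK Av dotZl dot_delta yi.
  exact: mulr0.
have qr y : peval q (reflection_mx (delta_mx i 0) *m y) = - peval q y.
  rewrite (mpolyE q) !peval_sum -sumrN; apply: eq_bigr => m _.
  rewrite !pevalZ -mulrN; have [mi|mi] := boolP (odd (m i)); last first.
    by rewrite (harmonic_odd lq hq) // !mul0r.
  congr (_ * _); rewrite /peval !mevalX (bigD1 i) // [in RHS](bigD1 i) //=.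
  rewrite reflection_delta eqxx exprNn -signr_odd mi expr1 mulN1r mulNr; congr (- (_ * _)).
  by apply: eq_bigr => j ji; rewrite reflection_delta (negPf ji).
have xE y : peval p y = peval q (A *m y).
  by rewrite peval_lsub mulmxA oA mul1mx.
rewrite !xE -qr -Ar; congr (peval q _).
by rewrite !mulmxA -(mulmxA _ A^T) oA mulmx1.
Qed.

End Substitution.

(** * Polynomials vanishing on hyperplanes *)

Section Lines.
Variables (R : realType) (n : nat).
Implicit Types (m : multinom n) (p q : {mpoly R[n]}) (u v w x y : 'cV[R]_n).

Definition line p x v : {poly R} :=
  \sum_(m <- msupp p) mcoeff m p *: \prod_i ((x i 0)%:P + v i 0 *: 'X) ^+ m i.

Lemma horner_line p x v t : (line p x v).[t] = peval p (x + t *: v).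
Proof.
rewrite {2}(mpolyE p) peval_sum /line horner_sum; apply: eq_bigr => m _.
rewrite hornerZ horner_prod pevalZ /peval mevalX; congr (_ * _).
apply: eq_bigr => i _; rewrite horner_exp !mxE hornerD hornerC hornerZ hornerX.
by rewrite [v i 0 * t]mulrC.
Qed.

Lemma size_line p x v : (size (line p x v) <= msize p)%N.
Proof.
rewrite /line big_seq; apply: (big_ind (fun q : {poly R} => (size q <= msize p)%N)).
- by rewrite size_poly0.
- by move=> q r hq hr; rewrite (leq_trans (size_polyD _ _)) // geq_max hq.
move=> m mp; rewrite (leq_trans (size_scale_leq _ _)) //.
apply: leq_trans (msize_mdeg_lt mp); rewrite (leq_trans (size_prod_leq _ _)) //.
rewrite leq_subLR mdegE addnS ltnS -sum1_card -big_split /=; apply: leq_sum => i _.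
rewrite (leq_trans (size_exp_leq _ _)) // add1n ltnS.
rewrite -[leqRHS]mul1n leq_mul2r orbC -subn1 leq_subLR.
rewrite (leq_trans (size_polyD _ _)) // geq_max (leq_trans (size_polyC_leq1 _)) //=.
by rewrite (leq_trans (size_scale_leq _ _)) // size_polyX.
Qed.

Lemma peval_neq0 p : p != 0 -> exists x, peval p x != 0.
Proof.
move=> p0; apply: contrapT => h; move/eqP: p0; apply; apply: peval_eq0 => x.
by apply/eqP; apply/negP => /negP px; apply: h; exists x.
Qed.

Lemma prod_neq0 I (s : seq I) (F : I -> {mpoly R[n]}) :
  (forall i, F i != 0) -> \prod_(i <- s) F i != 0.
Proof.
move=> F0; elim/big_ind: _ => [|p q p0 q0|i _]; [exact: oner_neq0| |exact: F0].
by rewrite mulf_neq0.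
Qed.

(** A product of nonzero linear forms is a nonzero polynomial, hence nonzero at some point. The
    factor 1 for zero vectors only serves to make every factor nonzero, as [prod_neq0] asks. *)
Lemma generic_direction (s : seq 'cV[R]_n) : (forall v, v \in s -> v != 0) ->
  exists q : 'cV[R]_n, forall v, v \in s -> dot v q != 0.
Proof.
move=> s0; have [|q] := @peval_neq0 (\prod_(v <- s) if v == 0 then (1 : {mpoly R[n]}) else lform v).
  by apply: prod_neq0 => v; case: (v =P 0) => [_|/eqP]; [exact: oner_neq0|exact: lform_neq0].
rewrite peval_prod prodf_seq_neq0 => /allP h; exists q => v vs.
by have /= := h v vs; rewrite (negPf (s0 v vs)) peval_lform.
Qed.

End Lines.

Section HyperplaneArrangement.
Variables (R : realType) (n : nat) (I : eqType) (s : seq I) (v : I -> 'cV[R]_n).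
Hypotheses (uniq_s : uniq s) (v_neq0 : {in s, forall i, v i != 0})
  (v_nonparallel : {in s &, forall i j c, v i = c *: v j -> i = j}).
Implicit Types (p : {mpoly R[n]}) (x q : 'cV[R]_n).

Definition off x := {in s, forall i, dot (v i) x != 0}.

(** Vectors that must not be orthogonal to the direction of a line through [x]: the first list makes
    the line meet every hyperplane, the second makes the parameters of any two meeting points
    differ. *)
Let coeffs x : seq 'cV[R]_n :=
  [seq v i | i <- s] ++
  [seq dot (v i) x *: v j - dot (v j) x *: v i | i <- s, j <- [seq j <- s | j != i]].

Let coeffs_neq0 x : off x -> forall u, u \in coeffs x -> u != 0.
Proof.
move=> ox u; rewrite mem_cat => /orP[/mapP[i si ->]|]; first exact: v_neq0.
case/allpairsPdep => i [j [si]]; rewrite mem_filter => /andP[ji sj] ->.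
rewrite subr_eq0; apply: contraNN ji => /eqP e; apply/eqP; apply: (@v_nonparallel _ _ sj si ((dot (v i) x)^-1 * dot (v j) x)).
by rewrite -scalerA -e scalerA mulVf ?scale1r // ox.
Qed.

(* The line through [x] in a generic direction meets the hyperplanes in [size s] distinct points. *)
Let line_eq0 p x q : off x -> (forall u, u \in coeffs x -> dot u q != 0) ->
  {in s, forall i y, dot (v i) y = 0 -> peval p y = 0} ->
  ((msize p <= size s)%N \/ (msize p <= (size s).+1)%N /\ peval p x = 0) ->
  line p x q = 0.
Proof.
move=> ox gq pv hsz; apply: contrapT => /eqP l0.
have q0 i : i \in s -> dot (v i) q != 0.
  by move=> si; apply: gq; rewrite mem_cat map_f.
pose t i := - dot (v i) x / dot (v i) q.
have tr i : i \in s -> root (line p x q) (t i).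
  move=> si; rewrite rootE horner_line (pv i) //.
  by rewrite dotDr dotZr divfK ?q0 // subrr.
have tu : uniq [seq t i | i <- s].
  rewrite map_inj_in_uniq // => i j si sj tij; apply/eqP; apply: contraT => ij.
  have /gq : dot (v i) x *: v j - dot (v j) x *: v i \in coeffs x.
    rewrite mem_cat; apply/orP; right; apply/allpairsPdep; exists i, j.
    by split=> //; rewrite mem_filter eq_sym ij.
  rewrite dotBl !dotZl subr_eq0 => /negP[]; apply/eqP.
  move/eqP: tij; rewrite /t !mulNr eqr_opp eqr_div ?q0 // => /eqP.
  by move->.
have sl := size_line p x q.
case: hsz => [sz|[sz px]].
  have := max_poly_roots l0 _ tu; rewrite size_map => /(_ _)/leq_trans/(_ sl).
  rewrite ltnNge sz => h; suff: false by []; apply: h.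
  by apply/allP => _ /mapP[i si ->]; exact: tr.
(* The parameter 0 of [x] itself is one more root, distinct from the others because [x] is off the
   hyperplanes. *)
have := max_poly_roots (rs := 0 :: [seq t i | i <- s]) l0.
rewrite /= size_map => /(_ _ _)/leq_trans/(_ sl); rewrite ltnNge sz => h.
suff: false by []; apply: h.
  rewrite rootE horner_line scale0r addr0 px eqxx /=.
  by apply/allP => _ /mapP[i si ->]; exact: tr.
rewrite tu andbT; apply/mapP => -[i si /esym/eqP].
by rewrite mulf_eq0 oppr_eq0 invr_eq0 (negPf (ox i si)) (negPf (q0 i si)).
Qed.

Lemma vanish_hyperplanes_lt p : (msize p <= size s)%N ->
  {in s, forall i y, dot (v i) y = 0 -> peval p y = 0} -> p = 0.
Proof.
(* The added factor vanishes on the hyperplanes, where [line_eq0] says nothing; it is cancelled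
   afterwards in the integral domain. *)
move=> sz pv; have : p * \prod_(i <- s) lform (v i) = 0.
  apply: peval_eq0 => x; rewrite pevalM peval_prod.
  have [/allP ox|] := boolP (all (fun i => dot (v i) x != 0) s).
    have [q gq] := generic_direction (coeffs_neq0 ox).
    have := horner_line p x q 0; rewrite (line_eq0 ox gq pv) ?horner0; last by left.
    by rewrite scale0r addr0 => <-; rewrite mul0r.
  case/allPn => i si /negbNE /eqP vi; rewrite (big_rem i) //= peval_lform vi.
  by rewrite mul0r mulr0.
move/eqP; rewrite mulf_eq0 => /orP[/eqP//|]; rewrite big_seq.
suff /negPf-> : \prod_(i <- s | i \in s) lform (v i) != 0 by [].
elim/big_ind: _ => [|p' q' p0 q0|i si]; [exact: oner_neq0| |exact/lform_neq0/v_neq0].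
by rewrite mulf_neq0.
Qed.

Lemma vanish_hyperplanes_eq p x : (msize p <= (size s).+1)%N ->
  {in s, forall i y, dot (v i) y = 0 -> peval p y = 0} ->
  off x -> peval p x = 0 -> p = 0.
Proof.
move=> sz pv ox px.
(* [G] vanishes at the points [y] for which the line from [x] to [y] is not generic, and it is not
   the zero polynomial. *)
pose G := \prod_(u <- coeffs x) (lform u - mpolyC n (dot u x)).
have GE y : peval G y = \prod_(u <- coeffs x) dot u (y - x).
  rewrite peval_prod; apply: eq_bigr => u _.
  by rewrite pevalB peval_lform pevalC dotBr.
have : p * G = 0.
  apply: peval_eq0 => y; rewrite pevalM GE.
  have [/allP gq|] := boolP (all (fun u => dot u (y - x) != 0) (coeffs x)).
    have := horner_line p x (y - x) 1; rewrite (line_eq0 ox gq pv) ?horner0; last by right.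
    by rewrite scale1r addrC subrK => <-; rewrite mul0r.
  case/allPn => u su /negbNE /eqP vu; rewrite (big_rem u) //= vu.
  by rewrite mul0r mulr0.
move/eqP; rewrite mulf_eq0 => /orP[/eqP//|/eqP G0].
have [q gq] := generic_direction (coeffs_neq0 ox).
have := GE (x + q); rewrite G0 peval0 => /esym/eqP; rewrite prodf_seq_eq0.
case/hasP => u su /=; rewrite (addrC x) addrK => uq.
by have := gq _ su; rewrite uq.
Qed.

End HyperplaneArrangement.

(** * The discrete Laplacian of a polynomial *)

Section DominantTerm.
Variables (R : realType) (n : nat).
Implicit Types (m : multinom n) (p q h : {mpoly R[n]}) (u v w x y : 'cV[R]_n).

Lemma msizeD_leq k p q : (msize p <= k)%N -> (msize q <= k)%N -> (msize (p + q) <= k)%N.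
Proof. by move=> hp hq; rewrite (leq_trans (msizeD_le _ _)) // geq_max hp. Qed.

Lemma msizeB_leq k p q : (msize p <= k)%N -> (msize q <= k)%N -> (msize (p - q) <= k)%N.
Proof. by move=> hp hq; apply: msizeD_leq; rewrite ?msizeN. Qed.

Lemma msizeZ_leq k c p : (msize p <= k)%N -> (msize (c *: p) <= k)%N.
Proof. exact/leq_trans/mmeasureZ_le. Qed.

Lemma msize_sum_leq k I (r : seq I) (P : pred I) (F : I -> {mpoly R[n]}) :
  (forall i, P i -> msize (F i) <= k)%N -> (msize (\sum_(i <- r | P i) F i) <= k)%N.
Proof.
move=> hF; elim/big_ind: _ => [|p q hp hq|i /hF//]; first by rewrite msize0.
exact: msizeD_leq.
Qed.

Lemma msizeM_leq p q : (msize (p * q) <= (msize p + msize q).-1)%N.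
Proof.
have [->|p0] := eqVneq p 0; first by rewrite mul0r msize0.
have [->|q0] := eqVneq q 0; first by rewrite mulr0 msize0.
by rewrite msizeM.
Qed.

Lemma msize_leqP k p : reflect (forall m, mcoeff m p != 0 -> (mdeg m < k)%N) (msize p <= k)%N.
Proof.
apply: (iffP idP) => [h m|h].
  by rewrite -mcoeff_msupp => /msize_mdeg_lt/leq_trans; apply.
rewrite msizeE big_seq; elim/big_ind: _ => [//|a b ak bk|m].
  by rewrite geq_max ak.
by rewrite mcoeff_msupp; exact: h.
Qed.

Lemma msize_mderiv i p : (msize (mderiv i p) <= (msize p).-1)%N.
Proof.
apply/msize_leqP => m; rewrite mcoeff_deriv mulrn_eq0 /= -mcoeff_msupp.
move=> /msize_mdeg_lt; rewrite mdegD mdeg1 addn1.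
by case: (msize p).
Qed.

Lemma msize_lap p : (msize (lap p) <= msize p - 2)%N.
Proof.
apply: msize_sum_leq => i _; rewrite subn2 (leq_trans (msize_mderiv _ _)) //.
by rewrite -!subn1 leq_sub2r // subn1 msize_mderiv.
Qed.

Lemma homog_msize_eq0 k h : h \is homog k -> (msize h <= k)%N -> h = 0.
Proof.
move=> /homogP hk /msize_leqP hm; apply/mpolyP => m; rewrite mcoeff0.
by apply/eqP/negPn/negP => h0; have := hm _ h0; rewrite (hk _ h0) ltnn.
Qed.

Lemma homog_msize_leq k h : h \is homog k -> (msize h <= k.+1)%N.
Proof. by move=> /homogP hk; apply/msize_leqP => m /hk ->. Qed.

Lemma homog_msize k h : h \is homog k -> h != 0 -> msize h = k.+1.
Proof.
move=> hk; apply: contra_neq_eq; rewrite neq_ltn ltnS => /orP[|].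
  exact: homog_msize_eq0.
by rewrite ltnNge homog_msize_leq.
Qed.

Lemma dominant_homog p : dominant p \is homog (msize p).-1.
Proof. exact: pihomogP. Qed.

Lemma mcoeff_pihomog k p m : mcoeff m (pihomog mdeg k p) = if mdeg m == k then mcoeff m p else 0.
Proof.
rewrite pihomogE raddf_sum /= big_mkcond /=.
case: eqP => mk; last first.
  apply: big1 => m' _; case: eqP => // m'k; rewrite mcoeffZ mcoeffX.
  by case: eqP => [e|_]; rewrite ?mulr0 //; case: mk; rewrite -e.
rewrite (congr1 (mcoeff m) (mpolyE p)) [RHS]raddf_sum /=; apply: eq_bigr => m' _.
rewrite mcoeffZ mcoeffX; case: eqP => //; case: eqP => [->|_ _]; last by rewrite mulr0.
by rewrite mk.
Qed.

Lemma dominant_rest p : (msize (p - dominant p) <= (msize p).-1)%N.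
Proof.
apply/msize_leqP => m; rewrite mcoeffB mcoeff_pihomog; case: (mdeg m =P (msize p).-1) => [|/eqP mp].
  by rewrite subrr eqxx.
rewrite subr0 -mcoeff_msupp => /msize_mdeg_lt.
by case: (msize p) mp => // k /= mk; rewrite ltnS leq_eqVlt (negPf mk).
Qed.

Lemma dominant_neq0 p : p != 0 -> dominant p != 0.
Proof.
move=> p0; apply: contraTneq (dominant_rest p) => ->.
by rewrite subr0 (mpolySpred mdeg p0) /= ltnn.
Qed.

Lemma msize_dominant p : msize (dominant p) = msize p.
Proof.
have [->|p0] := eqVneq p 0; first by rewrite /dominant pihomog0.
by rewrite (homog_msize (dominant_homog p)) ?dominant_neq0 // -mpolySpred.
Qed.

Lemma dominant_lead k h q : h \is homog k -> h != 0 -> (msize q <= k)%N ->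
  msize (h + q) = k.+1 /\ dominant (h + q) = h.
Proof.
move=> hk h0 hq; have s : msize (h + q) = k.+1.
  apply/eqP; rewrite eqn_leq msizeD_leq ?(homog_msize_leq hk) ?(leqW hq) //=.
  rewrite ltnNge; apply: contraNN h0 => sk; apply/eqP; apply: (homog_msize_eq0 hk).
  by rewrite -(addrK q h) msizeB_leq.
split; first exact: s.
apply/mpolyP => m.
rewrite mcoeff_pihomog s /= mcoeffD.
case: (mdeg m =P k) => [mk|mk]; last first.
  by apply/esym/eqP/negPn/negP => /(homogP hk).
by rewrite [mcoeff m q]memN_msupp_eq0 ?addr0 // msize_mdeg_ge // mk.
Qed.

Lemma poly_eq0_interval (q : {poly R}) e : 0 < e ->
  (forall t, 0 <= t -> t <= e -> q.[t] = 0) -> q = 0.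
Proof.
move=> e0 q0; apply/eqP; apply: contraT => qn0.
have := max_poly_roots qn0 (rs := [seq e / k.+1%:R | k <- iota 0 (size q)]).
rewrite size_map size_iota ltnn => /(_ _ _)/negP; case=> //.
  apply/allP => _ /mapP[k _ ->]; rewrite rootE q0 //.
    by rewrite divr_ge0 ?ltW.
  by rewrite ler_pdivrMr // ler_peMr ?ler1n ?ltW.
rewrite map_inj_uniq ?iota_uniq // => a b /(mulfI (lt0r_neq0 e0))/invr_inj/eqP.
by rewrite eqr_nat eqSS => /eqP.
Qed.

(** The restriction to the line has infinitely many roots, so it vanishes also at the parameter 1,
    which may lie beyond the segment. *)
Lemma peval_eq0_segment p x v e : 0 < e ->
  (forall t, 0 <= t -> t <= e -> peval p (x + t *: v) = 0) -> peval p (x + v) = 0.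
Proof.
move=> e0 h; have l0 : line p x v = 0.
  by apply: (poly_eq0_interval e0) => t t0 te; rewrite horner_line h.
by have := horner_line p x v 1; rewrite l0 horner0 scale1r.
Qed.

(** The value of the dominant term at [x] is the coefficient of index [(msize p).-1] of the
    polynomial [t |-> p (t x)], which is zero. *)
Lemma dominant_vanish p x : (forall t, peval p (t *: x) = 0) -> peval (dominant p) x = 0.
Proof.
move=> h; have l0 : line p 0 x = 0.
  by apply: poly_eq0_horner => t; rewrite horner_line add0r h.
rewrite -(coef0 R (msize p).-1) -l0 /dominant pihomogE peval_sum coef_sum big_mkcond /=.
apply: eq_bigr => m _; have -> : \prod_(i < n) (((0 : 'cV[R]_n) i 0)%:P + x i 0 *: 'X) ^+ m i =
    (\prod_i x i 0 ^+ m i) *: 'X^(mdeg m).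
  transitivity (\prod_(i < n) (x i 0 ^+ m i *: ('X : {poly R}) ^+ m i)).
    by apply: eq_bigr => i _; rewrite mxE polyC0 add0r exprZn.
  by rewrite scaler_prod prodrXr mdegE.
rewrite !coefZ coefXn eq_sym; case: eqP => _; last by rewrite !mulr0.
by rewrite mulr1 pevalZ /peval mevalX.
Qed.

End DominantTerm.

(** * Taylor expansion of the discrete Laplacian *)

Section Walk.
Variables (R : realType) (n : nat).
Implicit Types (m : multinom n) (p q h : {mpoly R[n]}) (s u v w x y : 'cV[R]_n).

Definition shift s p : {mpoly R[n]} :=
  comp_mpoly [tuple MX i + mpolyC n (s i 0) | i < n] p.

Lemma peval_shift s p x : peval (shift s p) x = peval p (x + s).
Proof.
rewrite /peval comp_mpoly_meval; apply: meval_eq => i.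
by rewrite tnth_mktuple -/(peval _ x) pevalD pevalX pevalC mxE.
Qed.

Definition ddir s p : {mpoly R[n]} := \sum_i s i 0 *: mderiv i p.

Lemma ddirD s p q : ddir s (p + q) = ddir s p + ddir s q.
Proof. by rewrite -big_split; apply: eq_bigr => i _; rewrite mderivD scalerDr. Qed.

Lemma ddirZ s c p : ddir s (c *: p) = c *: ddir s p.
Proof. by rewrite scaler_sumr; apply: eq_bigr => i _; rewrite mderivZ !scalerA mulrC. Qed.

Lemma ddirMX s i p : ddir s (MX i * p) = s i 0 *: p + MX i * ddir s p.
Proof.
transitivity (\sum_j (s j 0 *: ((j == i)%:R * p) + MX i * (s j 0 *: mderiv j p))).
  by apply: eq_bigr => j _; rewrite mderivM mderivXU scalerDr -scalerAr.
rewrite big_split /= -mulr_sumr; congr (_ + _).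
rewrite (bigD1 i) //= eqxx mul1r big1 ?addr0 // => j ji.
by rewrite (negPf ji) mul0r scaler0.
Qed.

Lemma msize_ddir s p : (msize (ddir s p) <= (msize p).-1)%N.
Proof. by apply: msize_sum_leq => i _; apply/msizeZ_leq/msize_mderiv. Qed.

(** Remainder of the second-order Taylor formula for the translation by [s]. *)
Definition taylor_rest s p := shift s p - (p + ddir s p + 2^-1 *: ddir s (ddir s p)).

Lemma taylor_restD s p q : taylor_rest s (p + q) = taylor_rest s p + taylor_rest s q.
Proof.
rewrite /taylor_rest !ddirD scalerDr [shift s (p + q)]comp_mpolyD -!/(shift s _).
set a := shift s p; set b := shift s q; ring.
Qed.

Lemma taylor_restZ s c p : taylor_rest s (c *: p) = c *: taylor_rest s p.
Proof.
rewrite /taylor_rest !ddirZ [shift s (c *: p)]comp_mpolyZ -!/(shift s _) scalerBr !scalerDr.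
by rewrite !scalerA [c * _]mulrC.
Qed.

Lemma taylor_restMX s i p : taylor_rest s (MX i * p) =
  (MX i + mpolyC n (s i 0)) * taylor_rest s p + (2^-1 * s i 0) *: ddir s (ddir s p).
Proof.
rewrite /taylor_rest; have -> : shift s (MX i * p) = (MX i + mpolyC n (s i 0)) * shift s p.
  apply: peval_inj => x; rewrite pevalM !peval_shift pevalM pevalD !pevalX pevalC.
  by rewrite mxE.
rewrite !ddirMX ddirD ddirMX ddirZ -!mul_mpolyC !mpolyCM.
have h2 : mpolyC n 2^-1 * 2 = 1 :> {mpoly R[n]}.
  by rewrite -[X in _ * X = _]mpolyC_nat -mpolyCM mulVf ?pnatr_eq0 // mpolyC1.
move: (mpolyC n 2^-1) h2 => c hc; set D1 := ddir s p; set D2 := ddir s D1.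
set e := mpolyC n (s i 0); set S := shift s p; set x := MX i.
apply/eqP; rewrite -subr_eq0; apply/eqP.
transitivity ((1 - c * 2) * (e * D1)); first by ring.
by rewrite hc subrr mul0r.
Qed.

(** By induction on the degree of monomials, one variable being split off with [taylor_restMX].
    Since subtraction is truncated, the bound also says that the remainder is zero in degree at most
    2. *)
Lemma msize_taylor_rest s p : (msize (taylor_rest s p) <= msize p - 3)%N.
Proof.
have T0 : taylor_rest s 0 = 0 by have := taylor_restZ s 0 0; rewrite !scale0r.
have hX k m : mdeg m = k -> (msize (taylor_rest s (mpolyX R m)) <= k - 2)%N.
  elim: k m => [|k IH] m mk.
    have -> : m = mnm0 by apply/eqP; rewrite -mdeg_eq0 mk.
    have d1 : ddir s 1 = 0.
      by apply: big1 => i _; rewrite -mpolyC1 mderivC scaler0.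
    rewrite mpolyX0 /taylor_rest d1 [ddir s 0](_ : _ = 0) ?scaler0 ?addr0.
      by rewrite [shift s 1]comp_mpoly1 subrr msize0.
    by apply: big1 => i _; rewrite mderiv0 scaler0.
  have [i mi] : exists i, m i != 0%N.
    apply/existsP; rewrite -negb_forall; apply/negP => /forallP h.
    by move: mk; rewrite mdegE big1 // => i _; exact/eqP/h.
  have mE : m = mnm_add (mnm1 i) (mnm_sub m (mnm1 i)) by rewrite addmC submK // lep1mP.
  move: (mnm_sub _ _) mE => m' mE; have {}mk : mdeg m' = k.
    by move: mk; rewrite mE mdegD mdeg1 => -[].
  rewrite mE mpolyXD taylor_restMX; apply: msizeD_leq; last first.
    apply: msizeZ_leq; rewrite subSS subn1 (leq_trans (msize_ddir _ _)) //.
    rewrite -!subn1 leq_sub2r // (leq_trans (msize_ddir _ _)) //.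
    by rewrite msizeX mk.
  have [->|t0] := eqVneq (taylor_rest s (mpolyX R m')) 0; first by rewrite mulr0 msize0.
  have := IH _ mk; have := t0; rewrite -msize_poly_eq0.
  set t := taylor_rest s _ => tn0 tk; rewrite (leq_trans (msizeM_leq _ _)) //.
  have x2 : (msize (MX i + mpolyC n (s i 0))%R <= 2)%N.
    by apply: msizeD_leq; rewrite ?msizeX ?mdeg1 // msizeC; case: eqP.
  lia.
rewrite {1}(mpolyE p) (big_morph (taylor_rest s) (taylor_restD s) T0).
rewrite big_seq; apply: msize_sum_leq => m /msize_mdeg_lt mp.
rewrite taylor_restZ; apply: msizeZ_leq; apply: (leq_trans (hX _ _ (erefl _))).
lia.
Qed.

Definition walk_op (S : {fset 'cV[R]_n}) (a : 'cV[R]_n -> R) p : {mpoly R[n]} :=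
  \sum_(s <- S) a s *: shift s p - p.

Lemma peval_walk_op S a p x : peval (walk_op S a p) x = discrete_laplacian S a (peval p) x.
Proof.
rewrite pevalB peval_sum; congr (_ - _).
by apply: eq_bigr => s _; rewrite pevalZ peval_shift.
Qed.

Lemma walk_opD S a p q : walk_op S a (p + q) = walk_op S a p + walk_op S a q.
Proof.
apply: peval_inj => x; rewrite pevalD !peval_walk_op /discrete_laplacian.
rewrite addrACA -opprD -pevalD -big_split /=; congr (_ - _).
by apply: eq_bigr => s _; rewrite pevalD mulrDr.
Qed.

Lemma walk_opZ S a c p : walk_op S a (c *: p) = c *: walk_op S a p.
Proof.
apply: peval_inj => x; rewrite pevalZ !peval_walk_op /discrete_laplacian.
rewrite mulrBr mulr_sumr -pevalZ; congr (_ - _).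
by apply: eq_bigr => s _; rewrite pevalZ mulrCA.
Qed.

Section Normalized.
Variables (S : {fset 'cV[R]_n}) (a : 'cV[R]_n -> R).
Hypotheses (a_sum1 : \sum_(s <- S) a s = 1)
  (a_drift0 : \sum_(s <- S) a s *: s = 0)
  (a_cov1 : forall i j : 'I_n, \sum_(s <- S) a s * (s i 0 * s j 0) = (i == j)%:R).

(** Averaged over the steps, the term of order zero cancels against [p] by the total mass, that of
    order one vanishes by the zero drift, and that of order two is half the Laplacian by the
    identity covariance. *)
Lemma msize_walk_op_lap p : (msize (walk_op S a p - 2^-1 *: lap p) <= msize p - 3)%N.
Proof.
suff -> : walk_op S a p - 2^-1 *: lap p = \sum_(s <- S) a s *: taylor_rest s p.
  by apply: msize_sum_leq => s _; apply/msizeZ_leq/msize_taylor_rest.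
have E0 : \sum_(s <- S) a s *: p = p by rewrite -scaler_suml a_sum1 scale1r.
have E1 : \sum_(s <- S) a s *: ddir s p = 0.
  transitivity (\sum_(s <- S) \sum_i (a s *: s) i 0 *: mderiv i p).
    apply: eq_bigr => s _; rewrite scaler_sumr; apply: eq_bigr => i _.
    by rewrite scalerA mxE.
  rewrite exchange_big big1 // => i _ /=; rewrite -scaler_suml -[X in X *: _]summxE a_drift0.
  by rewrite mxE scale0r.
have E2 : \sum_(s <- S) a s *: ddir s (ddir s p) = lap p.
  transitivity (\sum_(s <- S) \sum_i \sum_j (a s * (s i 0 * s j 0)) *: mderiv i (mderiv j p)).
    apply: eq_bigr => s _; rewrite scaler_sumr; apply: eq_bigr => i _.
    rewrite (raddf_sum (mderiv i)) !scaler_sumr; apply: eq_bigr => j _ /=.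
    by rewrite mderivZ !scalerA mulrA.
  rewrite exchange_big; apply: eq_bigr => i _; rewrite exchange_big (bigD1 i) //=.
  rewrite -scaler_suml a_cov1 eqxx mulr1n scale1r big1 ?addr0 // => j ji.
  by rewrite -scaler_suml a_cov1 eq_sym (negPf ji) mulr0n scale0r.
rewrite [RHS](_ : _ = \sum_(s <- S) a s *: shift s p - \sum_(s <- S) a s *: p
  - \sum_(s <- S) a s *: ddir s p - 2^-1 *: \sum_(s <- S) a s *: ddir s (ddir s p)).
  by rewrite E0 E1 E2 subr0.
rewrite [2^-1 *: _]scaler_sumr -!sumrB; apply: eq_bigr => s _.
by rewrite /taylor_rest scalerBr !scalerDr !scalerA [2^-1 * _]mulrC !opprD !addrA.
Qed.

(** [lap (dominant p)] is homogeneous of degree two less than [p], yet it is a difference of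
    polynomials of smaller degree: [lap p], because [walk_op] kills [p], and the Laplacian of the
    lower terms. *)
Lemma walk_harmonic_dominant p : walk_op S a p = 0 -> lap (dominant p) = 0.
Proof.
move=> Lp; apply: (homog_msize_eq0 (lap_homog (dominant_homog p))).
have -> : lap (dominant p) = lap p - lap (p - dominant p) by rewrite lapB opprB addrC subrK.
have -> : ((msize p).-1.-2 = msize p - 3)%N by case: (msize p) => [|[|[|]]] //= k; rewrite subSS !subnS subn0.
apply: msizeB_leq.
  have := msize_walk_op_lap p.
  by rewrite Lp sub0r msizeN msizeZ ?invr_eq0 ?pnatr_eq0.
rewrite (leq_trans (msize_lap _)) // (leq_trans (leq_sub2r 2 (dominant_rest p))) //.
by rewrite -subn1 -subnDA.
Qed.

Lemma msize_walk_op p : (msize (walk_op S a p) <= msize p - 2)%N.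
Proof.
rewrite -(subrK (2^-1 *: lap p) (walk_op S a p)); apply: msizeD_leq.
  by rewrite (leq_trans (msize_walk_op_lap p)) // leq_sub2l.
exact/msizeZ_leq/msize_lap.
Qed.

Lemma msize_walk_op_harmonic p : lap p = 0 -> (msize (walk_op S a p) <= msize p - 3)%N.
Proof. by move=> lp; have := msize_walk_op_lap p; rewrite lp scaler0 subr0. Qed.

End Normalized.
End Walk.

(** * The group generated by the reflections in the walls *)

Section SubgroupTheory.
Variables (R : realType) (n : nat).
Implicit Types (A B : 'M[R]_n) (T G : set 'M[R]_n).

Lemma orthogonal_subgroup_full : orthogonal_subgroup (@orthogonal_group R n).
Proof.
split=> //.
- by rewrite /orthogonal_group /= trmx1 mul1mx.
- by move=> A B oA oB; rewrite /orthogonal_group /= trmx_mul mulmxA -(mulmxA _ A^T) oA mulmx1.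
- by move=> A oA; rewrite orthogonal_inv //; exact: orthogonal_trmx.
Qed.

Lemma orthogonal_subgroup_smallest T : T `<=` @orthogonal_group R n ->
  orthogonal_subgroup (smallest (@orthogonal_subgroup R n) T).
Proof.
move=> To; split.
- by move=> A; apply; split=> //; exact: orthogonal_subgroup_full.
- by move=> G [[_ G1 _ _] _].
- by move=> A B GA GB G hG; have [[_ _ GM _] _] := hG; apply: GM; [exact: GA hG|exact: GB hG].
- by move=> A GA G hG; have [[_ _ _ GV] _] := hG; apply: GV; exact: GA hG.
Qed.

(* Through the determinant, every reflection of the group, not only those in
   [T], changes the sign of [h]. *)
Lemma det_invariant T (h : 'cV[R]_n -> R) :
  (forall A, T A -> [/\ orthogonal_group A, \det A = -1 & forall x, h (A *m x) = - h x]) ->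
  forall A, smallest (@orthogonal_subgroup R n) T A ->
  forall x, h (A *m x) = \det A * h x.
Proof.
move=> hT A WA; pose G := [set A : 'M[R]_n | orthogonal_group A /\ forall x, h (A *m x) = \det A * h x].
have : G A; last by case.
apply: WA; split; last first.
  by move=> B /hT[oB dB hB]; split=> // x; rewrite dB mulN1r.
have [oS o1 oM oV] := orthogonal_subgroup_full; split.
- by move=> B [].
- by split=> // x; rewrite mul1mx det1 mul1r.
- move=> B B' [oB hB] [oB' hB']; split; first exact: oM.
  by move=> x; rewrite -mulmxA hB hB' det_mulmx mulrA.
move=> B [oB hB]; split; first exact: oV.
move=> x; have uB := orthogonal_unit oB; have := hB (invmx B *m x).
rewrite mulmxA mulmxV // mul1mx => ->; rewrite det_inv mulrA mulVf ?mul1r //.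
by rewrite -unitfE -unitmxE.
Qed.

Lemma det_orthogonal_sqr A : orthogonal_group A -> \det A * \det A = 1.
Proof. by move=> oA; rewrite -{1}det_tr -det_mulmx oA det1. Qed.

End SubgroupTheory.

(** * Simplicial cones with inner normals [alpha] and dual edge vectors [z] *)

Section Cone.
Variables (R : realType) (d : nat) (alpha z : 'I_d -> 'cV[R]_d).
Hypotheses (alpha_z : forall i j, dot (alpha i) (z j) = (i == j)%:R)
  (expand_z : forall x, x = \sum_i dot (alpha i) x *: z i).
Implicit Types (p q h f : {mpoly R[d]}) (u v w x y : 'cV[R]_d) (A B : 'M[R]_d) (i j : 'I_d).

Definition cone : set 'cV[R]_d := [set x | forall i, 0 <= dot (alpha i) x].
Definition open_cone : set 'cV[R]_d := [set x | forall i, 0 < dot (alpha i) x].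
Definition wall_reflections : set 'M[R]_d := [set A | exists i, A = reflection_mx (alpha i)].
Definition wall_group : set 'M[R]_d := smallest (@orthogonal_subgroup R d) wall_reflections.
(** On the whole hyperplanes, not only on the faces of the cone; [vanish_boundary_walls] passes from
    the faces to the hyperplanes. *)
Definition vanish_walls f := forall i x, dot (alpha i) x = 0 -> peval f x = 0.

Let W := wall_group.

Lemma dot_sumr I (r : seq I) (F : I -> 'cV[R]_d) u :
  dot u (\sum_(i <- r) F i) = \sum_(i <- r) dot u (F i).
Proof. by apply: (big_morph (dot u)) => [x y|]; rewrite ?dotDr ?dot0r. Qed.

Lemma alpha_neq0 i : alpha i != 0.
Proof.
apply/eqP => a0; have := alpha_z i i; rewrite a0 dotC dot0r eqxx => /esym/eqP.
by rewrite oner_eq0.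
Qed.

Lemma dot_span u v : (forall i, dot u (z i) = dot v (z i)) -> u = v.
Proof.
move=> e; apply/eqP; rewrite -subr_eq0 -dot_eq0 {2}(expand_z (u - v)) dot_sumr.
by rewrite big1 // => i _; rewrite dotZr dotBl e subrr mulr0.
Qed.

Lemma expand_alpha x : x = \sum_i dot (z i) x *: alpha i.
Proof.
apply: dot_span => j; rewrite [RHS]dotC dot_sumr (bigD1 j) //= big1 => [|i ij].
  by rewrite addr0 dotZr [dot (z j) (alpha j)]dotC alpha_z eqxx mulr1 dotC.
by rewrite dotZr [dot (z j) _]dotC alpha_z (negPf ij) mulr0.
Qed.

Definition barycenter : 'cV[R]_d := \sum_i z i.

Lemma dot_barycenter i : dot (alpha i) barycenter = 1.
Proof.
rewrite dot_sumr (bigD1 i) //= big1 ?addr0 ?alpha_z ?eqxx // => j ji.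
by rewrite alpha_z eq_sym (negPf ji).
Qed.

Lemma barycenter_open : open_cone barycenter.
Proof. by move=> i; rewrite dot_barycenter. Qed.

Lemma open_cone_add x y s t : cone x -> open_cone y -> 0 <= s -> 0 < t ->
  open_cone (s *: x + t *: y).
Proof.
move=> cx cy s0 t0 i; rewrite dotDr !dotZr ltr_wpDl ?mulr_ge0 ?mulr_gt0 //; exact: cx.
Qed.

Lemma cone_peval_ge0 f : (forall x, open_cone x -> 0 < peval f x) ->
  forall x, cone x -> 0 <= peval f x.
Proof.
move=> fp x cx; have := horner_line f x barycenter 0; rewrite scale0r addr0 => <-.
apply: poly_ge0_closed => e e0; exists (e / 2); first by rewrite subr0 gtr0_norm; lra.
rewrite horner_line ltW // fp // -[x in x + _]scale1r.
by apply: open_cone_add barycenter_open _ _ => //; rewrite divr_gt0.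
Qed.

Lemma wall_reflections_sub : wall_reflections `<=` @reflections R d.
Proof. by move=> A [i ->]; exists (alpha i) => //; exact: alpha_neq0. Qed.

Lemma wall_group_subgroup : orthogonal_subgroup W.
Proof.
apply: orthogonal_subgroup_smallest => A [i ->].
exact/reflection_orthogonal/alpha_neq0.
Qed.

Lemma wall_group_orthogonal A : W A -> orthogonal_group A.
Proof. by have [h _ _ _] := wall_group_subgroup; exact: h. Qed.

Lemma wall_group_tr A : W A -> W A^T.
Proof.
move=> WA; rewrite -orthogonal_inv; last exact: wall_group_orthogonal.
by have [_ _ _ h] := wall_group_subgroup; exact: h.
Qed.

Lemma wall_group_reflection i : W (reflection_mx (alpha i)).
Proof. by apply: sub_gen_smallest; exists i. Qed.

Lemma wall_group_conj A v : W A -> W (reflection_mx v) -> W (reflection_mx (A *m v)).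
Proof.
move=> WA Wv; rewrite -reflection_conj; last exact: wall_group_orthogonal.
have [_ _ WM _] := wall_group_subgroup.
by apply: (WM _ _ (WM _ _ WA Wv)); exact: wall_group_tr.
Qed.

Lemma vanish_walls_det f : lap f = 0 -> vanish_walls f ->
  forall A, W A -> forall x, peval f (A *m x) = \det A * peval f x.
Proof.
move=> lf wf; apply: det_invariant => A [i ->]; have a0 := alpha_neq0 i.
split; [exact: reflection_orthogonal|exact: reflection_det|].
by apply: harmonic_reflection => // x; exact: wf.
Qed.

(** The reflection fixes the points of its mirror, while [f] changes sign under it because the
    determinant is -1. *)
Lemma vanish_walls_mirror f v : lap f = 0 -> vanish_walls f -> v != 0 ->
  W (reflection_mx v) -> forall x, dot v x = 0 -> peval f x = 0.
Proof.
move=> lf wf v0 Wv x vx; have := vanish_walls_det lf wf Wv x.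
have -> : reflection_mx v *m x = x by apply/eqP; rewrite reflection_fixed // vx.
by rewrite reflection_det // => h; lra.
Qed.

(** Together with the finiteness of the group, this makes the cone a chamber. It is obtained from a
    positive harmonic polynomial or, in the plane, from a given chamber. *)
Definition avoids_open_cone := forall v, v != 0 -> W (reflection_mx v) ->
  forall x, open_cone x -> dot v x != 0.

Lemma mirrors_avoid f : lap f = 0 -> vanish_walls f ->
  (forall x, open_cone x -> 0 < peval f x) -> avoids_open_cone.
Proof.
move=> lf wf fp v v0 Wv x ox; apply/eqP => vx.
by have := fp x ox; rewrite (vanish_walls_mirror lf wf v0 Wv vx) ltxx.
Qed.

Definition mirror_reflections : set 'M[R]_d := W `&` @reflections R d.

(** One of two opposite choices, with default value 0 off the reflections; [root] settles the
    sign. *)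
Definition unit_normal A : 'cV[R]_d := xget 0 [set v | dot v v = 1 /\ A = reflection_mx v].

Lemma unit_normalP A : reflections A ->
  dot (unit_normal A) (unit_normal A) = 1 /\ A = reflection_mx (unit_normal A).
Proof.
move=> [v v0 Av]; rewrite /unit_normal.
case: xgetP => [_ -> //|/(_ ((Num.sqrt (dot v v))^-1 *: v))]; case.
have vv := dot_gt0 v0; rewrite /= reflection_scale ?invr_eq0 ?sqrtr_eq0 -?ltNge //.
split=> //; rewrite dotZl dotZr mulrA -invfM -expr2 sqr_sqrtr ?ltW // mulVf //.
exact: lt0r_neq0.
Qed.

Lemma unit_normal_neq0 A : reflections A -> unit_normal A != 0.
Proof. by move=> /unit_normalP[e _]; rewrite -dot_eq0 e oner_eq0. Qed.

Lemma unit_normal_nonparallel A B c : reflections A -> reflections B ->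
  unit_normal A = c *: unit_normal B -> A = B.
Proof.
move=> rA rB e; have := unit_normal_neq0 rA; rewrite e scaler_eq0 negb_or => /andP[c0 _].
by rewrite (unit_normalP rA).2 e reflection_scale // -(unit_normalP rB).2.
Qed.

(** A nonzero polynomial cannot vanish on more hyperplanes than its degree, and [f] vanishes on all
    mirrors. *)
Lemma finite_mirror_reflections f : lap f = 0 -> vanish_walls f -> f != 0 ->
  finite_set mirror_reflections.
Proof.
move=> lf wf f0; apply: contrapT => inf.
have [B BM sB] := infinite_set_fset (msize f) inf.
have BW A : A \in (B : seq _) -> W A /\ reflections A by move=> AB; exact: BM.
move/eqP: f0; apply; apply: (@vanish_hyperplanes_lt R d _ (B : seq _) unit_normal).
- exact: fset_uniq.
- by move=> A /BW[_ /unit_normal_neq0].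
- by move=> A A' /BW[_ rA] /BW[_ rA'] c; exact: unit_normal_nonparallel.
- exact: sB.
move=> A /BW[WA rA] x; apply: vanish_walls_mirror => //; first exact: unit_normal_neq0.
by rewrite -(unit_normalP rA).2.
Qed.

(** An element is determined by its values on the basis [alpha]. Each [A *m alpha i] is normal to a
    mirror and as long as [alpha i], which leaves finitely many vectors. *)
Lemma finite_wall_group : finite_set mirror_reflections -> finite_set W.
Proof.
move=> fM; pose len i := Num.sqrt (dot (alpha i) (alpha i)).
pose V : set 'cV[R]_d := \bigcup_(i in [set: 'I_d])
  ([set len i *: unit_normal A | A in mirror_reflections] `|`
   [set - len i *: unit_normal A | A in mirror_reflections]).
have fV : finite_set V.
  by apply: bigcup_finite => // i _; rewrite finite_setU; split; exact: finite_image.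
(* [g] rebuilds a matrix from the images of the [alpha i], the coordinates being read off with the
   dual basis [z]. *)
pose g (F : {ffun 'I_d -> fset_set V}) : 'M[R]_d := \sum_i val (F i) *m (z i)^T.
apply: (@sub_finite_set _ _ (g @` setT)); last first.
  exact/finite_image/finite_finset.
move=> A WA; have oA := wall_group_orthogonal WA.
have AV i : A *m alpha i \in fset_set V.
  rewrite in_fset_set // inE; exists i => //; set r := reflection_mx (A *m alpha i).
  have Aa : A *m alpha i != 0.
    by rewrite -dot_eq0 orthogonal_dot // dot_eq0 alpha_neq0.
  have rr : reflections r by exists (A *m alpha i).
  have Mr : mirror_reflections r.
    by split=> //; apply: wall_group_conj => //; exact: wall_group_reflection.
  have [un ur] := unit_normalP rr.
  have [c c0 e] := reflection_parallel Aa (unit_normal_neq0 rr) ur.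
  have c2 : c ^+ 2 = len i ^+ 2.
    rewrite sqr_sqrtr ?dot_ge0 // -(orthogonal_dot _ _ oA) e dotZl dotZr un.
    by rewrite mulr1 expr2.
  have /orP[] : (c == len i) || (c == - len i) by rewrite -eqf_sqr c2.
    by move/eqP => cl; left; exists r => //; rewrite -cl.
  by move/eqP => cl; right; exists r => //; rewrite -cl.
exists [ffun i => [` AV i]%fset] => //; apply: eq_mulmx => x.
rewrite {2}(expand_alpha x) mulmx_sumr mulmx_suml; apply: eq_bigr => i _.
by rewrite ffunE /= mulmx_outer scalemxAr.
Qed.

(** * The product of the root forms, and the degree of positive harmonic polynomials *)

Section Chamber.
Hypotheses (finite_W : finite_set W) (avoid : avoids_open_cone).

Let y0 := barycenter.

Lemma finite_mirrors : finite_set mirror_reflections.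
Proof. by apply: sub_finite_set finite_W => A []. Qed.

Definition mirror_seq : seq 'M[R]_d := fset_set mirror_reflections.

Lemma mem_mirror_seq A : (A \in mirror_seq) = (A \in mirror_reflections).
Proof. by rewrite [LHS]in_fset_set //; exact: finite_mirrors. Qed.

Lemma mirror_seqP A : reflect (W A /\ reflections A) (A \in mirror_seq).
Proof. by rewrite mem_mirror_seq; apply: (iffP idP); rewrite inE. Qed.

Definition root A : 'cV[R]_d :=
  if 0 < dot (unit_normal A) y0 then unit_normal A else - unit_normal A.

Lemma rootP A : A \in mirror_seq ->
  [/\ dot (root A) (root A) = 1, A = reflection_mx (root A) & 0 < dot (root A) y0].
Proof.
move=> /mirror_seqP[WA rA]; have [un ur] := unit_normalP rA; rewrite /root.
case: ifP => [//|/negbT]; rewrite -leNgt => le0.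
rewrite dotNl dotNr opprK -scaleN1r reflection_scale ?oppr_eq0 ?oner_eq0 //; split=> //.
rewrite scaleN1r dotNl oppr_gt0 lt_neqAle le0 andbT.
by apply: avoid barycenter_open; rewrite -?ur //; exact: unit_normal_neq0.
Qed.

Lemma root_neq0 A : A \in mirror_seq -> root A != 0.
Proof. by move=> /rootP[e _ _]; rewrite -dot_eq0 e oner_eq0. Qed.

Lemma root_nonparallel : {in mirror_seq &, forall A B c, root A = c *: root B -> A = B}.
Proof.
move=> A B mA mB c e; have := root_neq0 mA; rewrite e scaler_eq0 negb_or => /andP[c0 _].
have [_ -> _] := rootP mA; have [_ eB _] := rootP mB.
by rewrite e reflection_scale // -eB.
Qed.

Lemma root_pos A x : A \in mirror_seq -> open_cone x -> 0 < dot (root A) x.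
Proof.
move=> mA ox; have [_ e y0p] := rootP mA; have [WA _] := mirror_seqP _ mA.
rewrite ltNge; apply/negP => xn.
(* This combination is orthogonal to [root A], and the assumed sign of [dot (root A) x] puts it in
   the open cone, which no mirror meets. *)
have op : open_cone (- dot (root A) x *: y0 + dot (root A) y0 *: x).
  apply: open_cone_add => //; last by rewrite oppr_ge0.
  by move=> i; exact/ltW/barycenter_open.
have := avoid (root_neq0 mA) _ op; rewrite -e => /(_ WA)/eqP; apply.
by rewrite dotDr !dotZr mulNr mulrC addNr.
Qed.

Definition root_product : {mpoly R[d]} := \prod_(A <- mirror_seq) lform (root A).

Let N := size mirror_seq.

Lemma peval_root_product x : peval root_product x = \prod_(A <- mirror_seq) dot (root A) x.
Proof. by rewrite peval_prod; apply: eq_bigr => A _; rewrite peval_lform. Qed.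

Lemma root_product_homog : root_product \is homog N.
Proof.
rewrite /root_product /N; elim: mirror_seq => [|A s IH].
  by rewrite big_nil; exact: dhomog1.
by rewrite big_cons /= -add1n; apply: dhomogM => //; exact: lform_homog.
Qed.

Lemma root_product_pos x : open_cone x -> 0 < peval root_product x.
Proof.
move=> ox; rewrite peval_root_product big_seq; apply: prodr_gt0 => A mA.
exact: root_pos.
Qed.

Lemma root_product_neq0 : root_product != 0.
Proof. by apply: contraTneq (root_product_pos barycenter_open) => ->; rewrite peval0 ltxx. Qed.

Lemma root_product_mirror A x : A \in mirror_seq -> dot (root A) x = 0 -> peval root_product x = 0.
Proof. by move=> mA e; rewrite peval_root_product (big_rem A) //= e mul0r. Qed.

Lemma mirror_seq_conj A B : W B -> A \in mirror_seq -> B^T *m A *m B \in mirror_seq.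
Proof.
move=> WB mA; have [WA _] := mirror_seqP _ mA; have [_ e _] := rootP mA.
have oB := orthogonal_trmx (wall_group_orthogonal WB).
rewrite e -{2}[B]trmxK reflection_conj //; apply/mirror_seqP; split.
  by apply: wall_group_conj; [exact: wall_group_tr | rewrite -e].
exists (B^T *m root A) => //; rewrite -dot_eq0 orthogonal_dot // dot_eq0.
exact: root_neq0.
Qed.

(** Conjugation by [B] permutes the mirrors, so the substitution of [B] permutes the root forms up
    to factors. *)
Lemma root_product_sign B : W B ->
  exists e, forall x, peval root_product (B *m x) = e * peval root_product x.
Proof.
move=> WB; have oB := wall_group_orthogonal WB; have oB' := orthogonal_trmx oB.
pose F A := B^T *m A *m B.
have Fin A : A \in mirror_seq -> F A \in mirror_seq by exact: mirror_seq_conj.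
have injF : injective F.
  move=> A A' /(congr1 (fun M => B *m M *m B^T)); rewrite /F !mulmxA.
  by rewrite (orthogonal_tr oB) !mul1mx -!mulmxA (orthogonal_tr oB) !mulmx1.
have pF : perm_eq (map F mirror_seq) mirror_seq.
  have uM : uniq mirror_seq by exact: fset_uniq.
  apply: uniq_perm; rewrite ?map_inj_uniq //.
  have sub : {subset map F mirror_seq <= mirror_seq}.
    by move=> A /mapP[A' mA' ->]; exact: Fin.
  have uF : uniq (map F mirror_seq) by rewrite map_inj_uniq.
  by have [] := uniq_min_size uF sub; rewrite ?size_map.
have sgn A : A \in mirror_seq -> exists e, B^T *m root A = e *: root (F A).
  move=> mA; have mF := Fin _ mA; have [_ eF _] := rootP mF; have [_ eA _] := rootP mA.
  have [|||e _ ->] := reflection_parallel (u := B^T *m root A) (v := root (F A)); last by exists e.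
  - by rewrite -dot_eq0 orthogonal_dot // dot_eq0 root_neq0.
  - exact: root_neq0.
  - by rewrite -eF -reflection_conj // trmxK -eA.
pose e A := xget 0 [set e | B^T *m root A = e *: root (F A)].
have eP A : A \in mirror_seq -> B^T *m root A = e A *: root (F A).
  by move=> /sgn; rewrite /e; case: xgetP => [_ -> //|h [c hc]]; have := h c.
exists (\prod_(A <- mirror_seq) e A) => x.
rewrite !peval_root_product -[X in _ = _ * X](perm_big _ pF) big_map -big_split /=.
by apply: eq_big_seq => A mA; rewrite orthogonal_dotl // eP // dotZl.
Qed.

(** The factor [e] of [root_product_sign] is found by cancelling the form of [root A] and evaluating
    the remaining product at a point that [A] fixes and that is off the other mirrors. *)
Lemma root_product_anti A x : A \in mirror_seq ->
  peval root_product (A *m x) = - peval root_product x.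
Proof.
move=> mA; have [WA _] := mirror_seqP _ mA; have [_ eA _] := rootP mA.
have [e he] := root_product_sign WA.
pose K : {mpoly R[d]} := \prod_(B <- rem A mirror_seq) lform (root B).
have PK : root_product = lform (root A) * K by rewrite /root_product (big_rem A).
have lA : lform (root A) != 0 by rewrite lform_neq0 ?root_neq0.
have : - lsub A K = e *: K.
  apply: (mulfI lA); apply: peval_inj => y; rewrite -scalerAr -PK pevalZ -he PK.
  rewrite !pevalM !peval_lform -[- lsub A K]scaleN1r pevalZ peval_lsub.
  have -> : dot (root A) (A *m y) = - dot (root A) y.
    have := reflection_self (root_neq0 mA); have := reflection_sym (root A).
    rewrite -eA => AT Ar; rewrite (orthogonal_dotl _ _ (wall_group_orthogonal WA)).
    by rewrite AT Ar dotNl.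
  by rewrite mulN1r mulrN mulNr.
(* A direction generic for the projections of the other roots to the mirror of [A] is itself
   projected to that mirror. *)
have [q gq] : exists q : 'cV[R]_d, {in rem A mirror_seq, forall B, dot (root B) q != 0} /\ dot (root A) q = 0.
  pose s := [seq root B - dot (root A) (root B) *: root A | B <- rem A mirror_seq].
  have [v|q gq] := @generic_direction R d s.
    move=> /mapP[B mB ->]; rewrite subr_eq0; apply: contraTneq mB => e'.
    have uM : uniq mirror_seq by exact: fset_uniq.
    apply/negP => mB; have := mB; rewrite mem_rem_uniq // inE => /andP[/eqP BA mB'].
    exact/BA/(root_nonparallel mB' mA e').
  have [A1 _ _] := rootP mA.
  exists (q - dot (root A) q *: root A); split; last first.
    by rewrite dotBr dotZr A1 mulr1 subrr.
  move=> B mB; have := gq _ (map_f _ mB); rewrite dotBl dotZl dotBr dotZr.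
  by rewrite [dot (root B) (root A)]dotC mulrC.
case: gq => gq qA /(congr1 (fun f => peval f q)).
have Aq : A *m q = q by apply/eqP; rewrite eA reflection_fixed ?root_neq0 // qA.
rewrite -scaleN1r !pevalZ peval_lsub Aq => /mulIf => e1.
rewrite he -e1 ?mulN1r // peval_prod prodf_seq_neq0; apply/allP => B mB /=.
by rewrite peval_lform gq.
Qed.

Lemma anti_mirror f : (forall A x, A \in mirror_seq -> peval f (A *m x) = - peval f x) ->
  {in mirror_seq, forall A x, dot (root A) x = 0 -> peval f x = 0}.
Proof.
move=> fA A mA x xA; have := fA A x mA; have [_ eA _] := rootP mA.
have -> : A *m x = x by apply/eqP; rewrite eA reflection_fixed ?root_neq0 // xA.
by move=> h; lra.
Qed.

Lemma vanish_walls_mirror_seq f : lap f = 0 -> vanish_walls f ->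
  {in mirror_seq, forall A x, dot (root A) x = 0 -> peval f x = 0}.
Proof.
move=> lf wf A mA; have [_ eA _] := rootP mA; have [WA _] := mirror_seqP _ mA.
by apply: vanish_walls_mirror => //; rewrite ?root_neq0 // -eA.
Qed.

Lemma wall_in_mirror_seq i : reflection_mx (alpha i) \in mirror_seq.
Proof.
apply/mirror_seqP; split; first exact: wall_group_reflection.
by exists (alpha i) => //; exact: alpha_neq0.
Qed.

(** The Laplacian commutes with reflections, so that of the product is antiinvariant and vanishes on
    all mirrors; its degree is too small for it to be nonzero. *)
Lemma root_product_harmonic : lap root_product = 0.
Proof.
apply: (@vanish_hyperplanes_lt _ _ _ mirror_seq root).
- exact: fset_uniq.
- by move=> A; exact: root_neq0.
- exact: root_nonparallel.
- rewrite (leq_trans (msize_lap _)) // leq_subLR.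
  by rewrite (leq_trans (homog_msize_leq root_product_homog)) // leqW.
apply: anti_mirror => A x mA; have oA : orthogonal_group A.
  by apply: wall_group_orthogonal; have [] := mirror_seqP _ mA.
rewrite -peval_lsub -lap_lsub // -[- peval _ x]mulN1r -pevalZ -lapZ.
congr (peval (lap _) x); apply: peval_inj => y.
by rewrite peval_lsub pevalZ mulN1r root_product_anti.
Qed.

Lemma root_product_walls : vanish_walls root_product.
Proof.
move=> i x ix; have mi := wall_in_mirror_seq i; have [_ e _] := rootP mi.
have [c c0 ac] := reflection_parallel (alpha_neq0 i) (root_neq0 mi) e.
apply: (root_product_mirror mi); apply: (mulfI c0).
by rewrite -dotZl -ac ix mulr0.
Qed.

Lemma harmonic_low_degree f : lap f = 0 -> vanish_walls f -> (msize f <= N)%N -> f = 0.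
Proof.
move=> lf wf sf; apply: (@vanish_hyperplanes_lt _ _ _ mirror_seq root) => //.
- exact: fset_uniq.
- by move=> A; exact: root_neq0.
- exact: root_nonparallel.
- exact: vanish_walls_mirror_seq.
Qed.

(** The difference of the two sides has degree at most [N] and vanishes on the [N] mirrors and at
    the further point [y0]. *)
Lemma harmonic_degreeN f : lap f = 0 -> vanish_walls f -> (msize f <= N.+1)%N ->
  f = (peval f y0 / peval root_product y0) *: root_product.
Proof.
move=> lf wf sf; apply/eqP; rewrite -subr_eq0; apply/eqP.
have P0 : peval root_product y0 != 0 by rewrite gt_eqF ?root_product_pos //; exact: barycenter_open.
apply: (@vanish_hyperplanes_eq _ _ _ mirror_seq root _ _ _ _ y0).
- exact: fset_uniq.
- by move=> A; exact: root_neq0.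
- exact: root_nonparallel.
- by rewrite msizeB_leq // msizeZ_leq // homog_msize_leq // root_product_homog.
- apply: vanish_walls_mirror_seq; first by rewrite lapB lapZ lf root_product_harmonic scaler0 subr0.
  by move=> i x ix; rewrite pevalB pevalZ (wf _ _ ix) (root_product_walls ix) mulr0 subr0.
- by move=> A mA; rewrite gt_eqF //; have [] := rootP mA.
by rewrite pevalB pevalZ divfK // subrr.
Qed.

(* The image of [x] closest to an interior point of the cone lies in the cone. *)
Lemma wall_group_cone x : exists2 A, W A & cone (A *m x).
Proof.
have [_ W1 WM _] := wall_group_subgroup.
have W1' : 1%:M \in fset_set W by rewrite in_fset_set // inE.
(* All images of [x] have the same norm, so the one closest to [y0] has the largest inner product
   with it. *)
pose F (A : fset_set W) := dot y0 (val A *m x).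
have [[A sA] _ Amax] := @arg_maxP _ _ _ [` W1']%fset xpredT F isT.
have WA : W A by move: (sA); rewrite in_fset_set // inE.
exists A => // i.
have WB := WM _ _ (wall_group_reflection i) WA.
have sB : reflection_mx (alpha i) *m A \in fset_set W by rewrite in_fset_set // inE.
(* Were [dot (alpha i) (A *m x)] negative, one more reflection would increase the inner product with
   [y0]. *)
have := Amax [` sB]%fset isT; rewrite /F /= -mulmxA reflection_mulmx dotBr dotZr.
rewrite [dot y0 (alpha i)]dotC dot_barycenter mulr1 gerBl pmulr_rge0 //.
by rewrite divr_gt0 // dot_gt0 ?alpha_neq0.
Qed.

(** Under the group, [h] and the root product are both multiplied by the determinant, so their
    product is invariant. It is nonnegative on the cone, hence everywhere, and its Gaussian
    expectation is not zero, against the orthogonality of distinct degrees. *)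
Lemma positive_harmonic_degree k h : h \is homog k -> lap h = 0 -> vanish_walls h ->
  (forall x, open_cone x -> 0 < peval h x) -> k = N.
Proof.
move=> hk lh wh hp; apply/eqP/negPn/negP => kN.
have E0 := gauss_harmonic_ortho hk root_product_homog lh root_product_harmonic kN.
suff : 0 < gauss (h * root_product) by rewrite E0 ltxx.
have h0 : h != 0 by apply: contraTneq (hp _ barycenter_open) => ->; rewrite peval0 ltxx.
apply: gauss_gt0; last by rewrite mulf_neq0 // root_product_neq0.
move=> x; have [A WA Ax] := wall_group_cone x.
rewrite -[peval _ x]mul1r -(det_orthogonal_sqr (wall_group_orthogonal WA)) pevalM.
rewrite mulrACA -(vanish_walls_det lh wh WA).
rewrite -(vanish_walls_det root_product_harmonic root_product_walls WA).
by rewrite mulr_ge0 // cone_peval_ge0 //; exact: root_product_pos.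
Qed.

End Chamber.
End Cone.

(** * Topology of the cone *)

Section ColumnTopology.
Variables (R : realType) (n : nat).
Implicit Types (u v x y : 'cV[R]_n) (A K : set 'cV[R]_n).

Lemma dot_continuous u : continuous (dot u).
Proof.
suff h (s : seq 'I_n) : continuous (fun x => \sum_(i <- s) u i 0 * x i 0) by exact: h.
elim: s => [|i s IH].
  rewrite (_ : (fun y => _) = fun=> 0); first exact: cst_continuous.
  by apply/funext => y; rewrite big_nil.
have ci : continuous (fun y : 'cV[R]_n => u i 0 * y i 0).
  move=> x; have h1 : (fun _ : 'cV[R]_n => u i 0) @ x --> u i 0.
    by apply: cvg_cst; exact: (nbhs_filter x).
  have h2 : (fun y : 'cV[R]_n => y i 0) @ x --> x i 0 by exact: coord_continuous.
  exact: (cvgM h1 h2).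
rewrite (_ : (fun y => _) = fun y : 'cV[R]_n => u i 0 * y i 0 + \sum_(j <- s) u j 0 * y j 0).
  by move=> x; exact: (cvgD (ci x) (IH x)).
by apply/funext => y; rewrite big_cons.
Qed.

Lemma line_continuous x v : continuous (fun t : R => x + t *: v).
Proof.
move=> t; have h1 : (fun _ : R => x) @ t --> x.
  by apply: cvg_cst; exact: (nbhs_filter t).
have h2 : (fun s : R => s *: v) @ t --> t *: v by apply: cvgZr_tmp; exact: cvg_id.
exact: (cvgD h1 h2).
Qed.

Lemma nbhs_line x v A : nbhs x A ->
  exists2 e, 0 < e & forall t, `|t| <= e -> A (x + t *: v).
Proof.
move=> xA; have : nbhs 0 ((fun t : R => x + t *: v) @^-1` A).
  by apply: line_continuous; rewrite scale0r addr0.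
move=> /nbhs_ballP[e /= e0 he]; exists (e / 2); first by rewrite divr_gt0.
move=> t te; apply: he; rewrite /ball /= sub0r normrN (le_lt_trans te) //.
by rewrite gtr_pMr // invf_lt1 // ltr1n.
Qed.

Lemma connected_dot_eq0 u K x y : connected K -> K x -> K y ->
  dot u x <= 0 -> 0 <= dot u y -> exists2 w, K w & dot u w = 0.
Proof.
move=> cK Kx Ky x0 y0.
have /connected_intervalP iK : connected (dot u @` K).
  apply: connected_continuous_connected => //.
  exact/continuous_subspaceT/dot_continuous.
have [w Kw w0] : (dot u @` K) 0.
  apply: (iK (dot u x) (dot u y)); [by exists x|by exists y|by rewrite x0 y0].
by exists w.
Qed.

Lemma segment_connected_cV x v : connected [set x + t *: v | t in `[0, 1]%classic].
Proof.
apply: connected_continuous_connected; first exact: segment_connected.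
exact/continuous_subspaceT/line_continuous.
Qed.

Lemma star_connected A x : A x ->
  (forall y t, A y -> 0 <= t -> t <= 1 -> A (x + t *: (y - x))) -> connected A.
Proof.
move=> Ax sA.
have -> : A = \bigcup_(y in A) [set x + t *: (y - x) | t in `[0, 1]%classic].
  apply/seteqP; split=> [y Ay|_ [y Ay [t + <-]]]; last first.
    by rewrite /= in_itv /= => /andP[t0 t1]; exact: sA.
  by exists y => //; exists 1; rewrite /= ?in_itv /= ?lexx ?ler01 // scale1r addrC subrK.
apply: bigcup_connected => [|y _]; last exact: segment_connected_cV.
by exists x => y _; exists 0; rewrite /= ?in_itv /= ?lexx ?ler01 // scale0r addr0.
Qed.

End ColumnTopology.

(** * Interior and boundary of a simplicial cone, and its description as a chamber *)

Section ConeTopology.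
Variables (R : realType) (d : nat) (alpha z : 'I_d -> 'cV[R]_d).
Hypotheses (alpha_z : forall i j, dot (alpha i) (z j) = (i == j)%:R)
  (expand_z : forall x, x = \sum_i dot (alpha i) x *: z i).
Implicit Types (u v w x y : 'cV[R]_d) (A B : 'M[R]_d) (i j : 'I_d).

Local Notation C := (cone alpha).
Local Notation C0 := (open_cone alpha).

Lemma open_cone_open : open C0.
Proof.
rewrite openE => x ox; apply: (@filter_forall _ _ _ _ (nbhs_filter x)) => i.
have : open (dot (alpha i) @^-1` [set t | 0 < t]).
  by apply: open_comp; [move=> y _; exact: dot_continuous|exact: open_gt].
by rewrite openE; apply; exact: ox.
Qed.

Lemma cone_closed : closed C.
Proof.
have -> : C = \bigcap_(i in [set: 'I_d]) (dot (alpha i) @^-1` [set t | 0 <= t]).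
  by apply/seteqP; split=> [x cx i _|x cx i]; [exact: (cx i)|exact: (cx i I)].
apply: closed_bigI => i _; by apply: preimage_closed; [move=> y _; exact: dot_continuous|exact: closed_ge].
Qed.

Lemma open_cone_sub : C0 `<=` C.
Proof. by move=> x ox i; exact/ltW/ox. Qed.

Lemma interior_cone : interior C = C0.
Proof.
apply/seteqP; split=> [x xC i|x ox]; last first.
  by apply: filterS open_cone_sub _; have := open_cone_open; rewrite openE; exact.
have [e e0 he] := nbhs_line (z i) xC.
have := he (- e) ltac:(by rewrite normrN gtr0_norm) i.
by rewrite dotDr dotZr alpha_z eqxx mulr1; lra.
Qed.

Lemma closure_cone : closure C = C.
Proof. by apply/esym/closure_id/cone_closed. Qed.

Lemma closure_open_cone : closure C0 = C.
Proof.
apply/seteqP; split=> [x xc|x xC B].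
  by rewrite -closure_cone; apply: closureS xc; exact: open_cone_sub.
move=> /(nbhs_line (barycenter z))[e e0 he]; exists (x + e *: barycenter z); split.
  rewrite -[x in x + _]scale1r; apply: open_cone_add => //.
  exact: barycenter_open.
by apply: he; rewrite gtr0_norm.
Qed.

Lemma boundary_cone x : boundary C x <-> C x /\ exists i, dot (alpha i) x = 0.
Proof.
rewrite /boundary closure_cone interior_cone; split=> [[xC xo]|[xC [i xi]]]; last first.
  by split=> // /(_ i); rewrite xi ltxx.
split=> //; apply: contrapT => h; apply: xo => i; rewrite lt_neqAle xC andbT eq_sym.
by apply/eqP => xi; apply: h; exists i.
Qed.

(** The open cone is star-shaped about the barycenter and meets no mirror; as the walls lie on
    mirrors, a connected set that avoids the mirrors cannot leave it. *)
Lemma chamber_cone : finite_set (wall_group alpha) -> avoids_open_cone alpha ->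
  is_finite_coxeter_chamber C.
Proof.
move=> fW av; exists (wall_group alpha).
  split=> //; exists (wall_reflections alpha) => //.
  exact: wall_reflections_sub alpha_z.
have oy : C0 (barycenter z) by exact: barycenter_open.
have sub : C0 `<=` ~` mirrors (wall_group alpha).
  by move=> x ox [v [v0 Wv vx]]; have /eqP := av v v0 Wv x ox.
exists (barycenter z); first exact: sub.
suff -> : connected_component (~` mirrors (wall_group alpha)) (barycenter z) = C0.
  by rewrite closure_open_cone.
apply/seteqP; split=> [x Kx i|]; last first.
  apply: connected_component_max => //; apply: (star_connected oy) => y t cy t0 t1.
  rewrite scalerBr addrCA -{1}[barycenter z]scale1r -scalerBl.
  have [->|tn] := eqVneq t 0; first by rewrite scale0r add0r subr0 scale1r.
  rewrite addrC; apply: open_cone_add => //; [exact: open_cone_sub| | ]; first by rewrite subr_ge0.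
  by rewrite lt_neqAle eq_sym tn.
rewrite ltNge; apply/negP => xi.
have [||w Kw wi] := connected_dot_eq0 (u := alpha i) (y := barycenter z) (@component_connected _ _ _) Kx _ xi.
- exact/connected_component_refl/sub.
- by apply/ltW; exact: oy.
apply: (connected_component_sub Kw); exists (alpha i); split=> //.
  exact: alpha_neq0 alpha_z i.
exact: wall_group_reflection.
Qed.

(** * Position of the mirrors of a group that has the cone as a chamber *)

Section Converse.
Variable W : set 'M[R]_d.
Hypotheses (fW : finite_set W) (cW : weyl_chamber W C).

(** The linear form of [v] has constant sign on the component, hence on its closure; a nonzero form
    of constant sign on the cone has no zero in the interior. *)
Lemma weyl_chamber_avoids v x : v != 0 -> W (reflection_mx v) -> C0 x -> dot v x != 0.
Proof.
move=> v0 Wv ox; apply/eqP => vx; have [x0 mx0 CE] := cW.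
set K := connected_component _ _ in CE.
have Kx0 : K x0 by exact: connected_component_refl.
wlog vx0 : v v0 Wv vx / 0 <= dot v x0.
  move=> h; have [/h|vx0] := leP 0 (dot v x0); first exact.
  apply: (h (- v)); rewrite ?oppr_eq0 ?dotNl ?vx ?oppr0 ?oppr_ge0 ?(ltW vx0) //.
  by rewrite -scaleN1r reflection_scale // oppr_eq0 oner_eq0.
have Kv y : K y -> 0 <= dot v y.
  move=> Ky; rewrite leNgt; apply/negP => vy.
  have [w Kw vw] := connected_dot_eq0 (@component_connected _ _ _) Ky Kx0 (ltW vy) vx0.
  by apply: (connected_component_sub Kw); exists v.
have Cv y : C y -> 0 <= dot v y.
  have cv : closed (dot v @^-1` [set t | 0 <= t]).
    by apply: preimage_closed; [move=> w _; exact: dot_continuous|exact: closed_ge].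
  by rewrite CE => Ky; have := closureS Kv Ky; rewrite -(closure_id _).1.
have [e e0 he] := nbhs_line v (open_cone_open ox).
have := Cv _ (open_cone_sub (he (- e) ltac:(by rewrite normrN gtr0_norm))).
rewrite dotDr vx dotZr add0r mulNr oppr_ge0 leNgt mulr_gt0 //.
exact: dot_gt0.
Qed.

Lemma mirrors_closed : closed (mirrors W).
Proof.
have -> : mirrors W = \bigcup_(A in W `&` @reflections R d) [set x | A *m x = x].
  apply/seteqP; split=> [x [v [v0 Wv vx]]|x [A [WA [v v0 Av]] Ax]].
    exists (reflection_mx v); first by split=> //; exists v.
    by apply/eqP; rewrite reflection_fixed //; exact/eqP.
  exists v; split=> //; first by rewrite -Av.
  by apply/eqP; rewrite -reflection_fixed // -Av; exact/eqP.
apply: closed_bigcup => [|A [_ [v v0 ->]]]; first by apply: sub_finite_set fW => A [].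
have -> : [set x | reflection_mx v *m x = x] = dot v @^-1` [set t | t = 0].
  by apply/seteqP; split=> x /= /eqP h; apply/eqP; rewrite -?reflection_fixed // reflection_fixed.
by apply: preimage_closed; [move=> w _; exact: dot_continuous|exact: closed_eq].
Qed.

(** A point off the closed set of mirrors has a ball off the mirrors. If the point is in the
    chamber, the ball meets the component, hence lies in it, and the point is interior. *)
Lemma weyl_chamber_boundary x : C x -> ~ C0 x -> mirrors W x.
Proof.
move=> xC xo; apply: contrapT => mx; have [x0 mx0 CE] := cW.
set K := connected_component _ _ in CE.
have Kx0 : K x0 by exact: connected_component_refl.
have : nbhs x (~` mirrors W).
  by have := closed_openC mirrors_closed; rewrite openE; exact.
move=> /nbhs_ballP[e /= e0 he]; set B := ball x e in he.
have cB : connected B.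
  apply: (@star_connected _ _ _ x); first exact: ballxx.
  move=> y t xy t0 t1; move: xy; rewrite /B -!ball_normE /= => xy.
  rewrite opprD addrA subrr add0r normrN normrZ distrC ger0_norm //.
  by apply: le_lt_trans xy; rewrite ler_piMl.
have nB : nbhs x B by exact: nbhsx_ballx.
have [y [Ky By]] : (K `&` B) !=set0 by move: xC; rewrite CE => /(_ _ nB).
have KB : K `|` B `<=` K.
  apply: connected_component_max; first by left.
    by move=> w [/connected_component_sub|/he].
  by apply: connectedU => //; [exists y|exact: component_connected].
apply: xo; rewrite -interior_cone CE; apply: filterS nB => w Bw.
by apply: subset_closure; apply: KB; right.
Qed.

End Converse.
End ConeTopology.

(** * Uniqueness and existence of a+-polynomials *)

Section BoundedDegree.
Variables (R : realType) (n K : nat) (F : {mpoly R[n]} -> {mpoly R[n]}).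
Hypotheses (FD : forall p q, F (p + q) = F p + F q) (FZ : forall c p, F (c *: p) = c *: F p)
  (F_bound : forall p, (msize p <= K)%N -> (msize (F p) <= K)%N)
  (F_inj : forall p, (msize p <= K)%N -> F p = 0 -> p = 0).

(** An injective endomorphism of a finite-dimensional space is onto; [P] and [D] identify the
    polynomials of size at most [K] with the row vectors of their coefficients. *)
Lemma bounded_degree_surj g : (msize g <= K)%N -> exists2 p, (msize p <= K)%N & F p = g.
Proof.
move=> gK; pose B : finType := bmultinom n K; pose e (k : 'I_#|B|) : multinom n := bmnm (enum_val k).
pose P (r : 'rV[R]_#|B|) : {mpoly R[n]} := \sum_k r 0 k *: mpolyX R (e k).
pose D (p : {mpoly R[n]}) : 'rV[R]_#|B| := \row_k mcoeff (e k) p.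
have PK r : (msize (P r) <= K)%N.
  by apply: msize_sum_leq => k _; apply: msizeZ_leq; rewrite msizeX; exact: bmdeg.
have DK p : (msize p <= K)%N -> P (D p) = p.
  move=> pK; rewrite [RHS](mpolywE pK) /P (reindex (enum_val : 'I_#|B| -> B)) /=; last first.
    exact/onW_bij/enum_val_bij.
  by apply: eq_bigr => k _; rewrite mxE.
have PD r : D (P r) = r.
  apply/rowP => k; rewrite mxE raddf_sum (bigD1 k) //= big1 => [|l lk].
    by rewrite addr0 mcoeffZ mcoeffX eqxx mulr1.
  rewrite mcoeffZ mcoeffX; case: eqP => [|_]; last by rewrite mulr0.
  by move=> /val_inj/enum_val_inj lk'; rewrite lk' eqxx in lk.
have F0 : F 0 = 0 by have := FZ 0 0; rewrite !scale0r.
pose A := \matrix_(k < #|B|, l < #|B|) mcoeff (e l) (F (mpolyX R (e k))).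
have AE r : r *m A = D (F (P r)).
  apply/rowP => l; rewrite !mxE (big_morph F FD F0) raddf_sum.
  by apply: eq_bigr => k _; rewrite FZ /= mcoeffZ mxE.
have uA : A \in unitmx.
  rewrite -row_free_unit -kermx_eq0; apply/eqP/row_matrixP => i; rewrite row0.
  have : row i (kermx A) *m A = 0 by rewrite -row_mul mulmx_ker row0.
  set r := row i _; rewrite AE => /(congr1 P); rewrite DK ?F_bound //.
  rewrite [P 0](_ : _ = 0) => [|]; last by apply: big1 => k _; rewrite mxE scale0r.
  by move=> /(F_inj (PK r)) /(congr1 D); rewrite PD => ->; apply/rowP => k; rewrite !mxE mcoeff0.
exists (P (D g *m invmx A)) => //.
by rewrite -[LHS]DK ?F_bound // -AE mulmxKV // DK.
Qed.

End BoundedDegree.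

(** * The dominant term of an a+-polynomial on a simplicial cone, and uniqueness *)

Section WalkInCone.
Variables (R : realType) (d : nat) (alpha z : 'I_d -> 'cV[R]_d).
Hypotheses (alpha_z : forall i j, dot (alpha i) (z j) = (i == j)%:R)
  (expand_z : forall x, x = \sum_i dot (alpha i) x *: z i).
Variables (S : {fset 'cV[R]_d}) (a : 'cV[R]_d -> R).
Hypotheses (a_sum1 : \sum_(s <- S) a s = 1)
  (a_drift0 : \sum_(s <- S) a s *: s = 0)
  (a_cov1 : forall i j : 'I_d, \sum_(s <- S) a s * (s i 0 * s j 0) = (i == j)%:R).
Implicit Types (P Q f h : {mpoly R[d]}) (x y : 'cV[R]_d).

Local Notation C := (cone alpha).
Local Notation C0 := (open_cone alpha).

Lemma vanish_boundary_walls f : (forall x, boundary C x -> peval f x = 0) -> vanish_walls alpha f.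
Proof.
(* [y] lies in the relative interior of the [i]-th face. A short segment from [y] towards [x] stays
   in that face, and its line reaches [x]. *)
move=> bf i x xi; pose y := barycenter z - z i.
have [e e0 he] := nbhs_line (x - y) (open_cone_open (barycenter_open alpha_z)).
rewrite -(subrK y x) addrC; apply: (peval_eq0_segment e0) => t t0 te.
have yi : dot (alpha i) (y + t *: (x - y)) = 0.
  by rewrite dotDr dotZr dotBr xi dotBr dot_barycenter // alpha_z eqxx subrr subr0 mulr0 addr0.
apply: bf; apply/(boundary_cone alpha_z); split; last by exists i.
move=> j; have [<-|ij] := eqVneq i j; first by rewrite yi.
have := he t ltac:(by rewrite ger0_norm) j.
have -> : barycenter z + t *: (x - y) = y + t *: (x - y) + z i by rewrite addrAC subrK.
by rewrite dotDr alpha_z eq_sym (negPf ij) addr0; exact: ltW.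
Qed.

Lemma walls_vanish_boundary f : vanish_walls alpha f -> forall x, boundary C x -> peval f x = 0.
Proof. by move=> wf x /(boundary_cone alpha_z)[_ [i]]; exact: wf. Qed.

(** A polynomial that vanishes on the cone is zero, because the segment from the barycenter towards
    any point begins in the cone. *)
Lemma harmonic_cone_walk_op f : discrete_harmonic S a C (peval f) <-> walk_op S a f = 0.
Proof.
split=> [hf|f0 x _]; last by rewrite -peval_walk_op f0 peval0.
apply: peval_eq0 => x; pose y := barycenter z.
have [e e0 he] := nbhs_line (x - y) (open_cone_open (barycenter_open alpha_z)).
rewrite -(subrK y x) addrC; apply: (peval_eq0_segment e0) => t t0 te.
rewrite peval_walk_op; apply: hf; apply: open_cone_sub; apply: he.
by rewrite ger0_norm.
Qed.

Lemma vanish_walls_dominant f : vanish_walls alpha f -> vanish_walls alpha (dominant f).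
Proof.
by move=> wf i x xi; apply: dominant_vanish => t; apply: (wf i); rewrite dotZr xi mulr0.
Qed.

Lemma aplus_dominant P : aplus_polynomial S a C P ->
  [/\ lap (dominant P) = 0, vanish_walls alpha (dominant P) &
      forall x, C0 x -> 0 < peval (dominant P) x].
Proof.
case=> P0 /harmonic_cone_walk_op LP /vanish_boundary_walls wP posP; split.
- exact: walk_harmonic_dominant a_sum1 a_drift0 a_cov1 _ LP.
- exact: vanish_walls_dominant.
by move=> x ox; apply: posP; rewrite (interior_cone alpha_z).
Qed.

Lemma aplus_wall_group P : aplus_polynomial S a C P ->
  finite_set (wall_group alpha) /\ avoids_open_cone alpha.
Proof.
move=> aP; have [lh wh hp] := aplus_dominant aP; split; last first.
  exact: (mirrors_avoid alpha_z lh wh hp).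
apply: (finite_wall_group alpha_z expand_z); apply: (finite_mirror_reflections alpha_z lh wh).
by case: aP => P0 _ _ _; exact: dominant_neq0.
Qed.

Lemma aplus_unique P Q : aplus_polynomial S a C P -> aplus_polynomial S a C Q ->
  exists2 c, 0 < c & Q = c *: P.
Proof.
move=> aP aQ; have [fW av] := aplus_wall_group aP.
have [lP wP pP] := aplus_dominant aP; have [lQ wQ pQ] := aplus_dominant aQ.
pose N := size (mirror_seq alpha); pose y := barycenter z.
(* The degree of every a+-polynomial is the number of mirrors. *)
have sz f : aplus_polynomial S a C f -> (msize f).-1 = N.
  move=> af; have [lf wf pf] := aplus_dominant af.
  exact: (positive_harmonic_degree alpha_z fW av (dominant_homog f) lf wf pf).
have oy : C0 y := barycenter_open alpha_z.
pose c := peval (dominant Q) y / peval (dominant P) y.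
have c0 : 0 < c by rewrite divr_gt0 ?pP ?pQ.
have dE f : aplus_polynomial S a C f -> dominant f =
    (peval (dominant f) y / peval (root_product alpha z) y) *: root_product alpha z.
  move=> af; have [lf wf pf] := aplus_dominant af.
  apply: (harmonic_degreeN alpha_z fW av lf wf).
  by have := homog_msize_leq (dominant_homog f); rewrite (sz f af).
have r0 : 0 < peval (root_product alpha z) y.
  exact: (root_product_pos alpha_z fW av oy).
have dQP : dominant Q = c *: dominant P.
  rewrite (dE Q aQ) (dE P aP) scalerA; congr (_ *: _).
  by rewrite /c; have P0 := pP _ oy; field; rewrite !gt_eqF.
exists c => //; apply/eqP; rewrite -subr_eq0; apply: contraT => f0.
have [P0 /harmonic_cone_walk_op LP /vanish_boundary_walls vP _] := aP.
have [Q0 /harmonic_cone_walk_op LQ /vanish_boundary_walls vQ _] := aQ.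
(* The dominant terms cancel, so [f] has degree below [N]; its own dominant term is harmonic and
   vanishes on the walls, hence is zero. *)
set f := Q - c *: P in f0.
have fE : f = (Q - dominant Q) - c *: (P - dominant P).
  by rewrite /f scalerBr -dQP opprB addrA subrK.
have sf : (msize f <= N)%N.
  have r g : aplus_polynomial S a C g -> (msize (g - dominant g) <= N)%N.
    by move=> ag; rewrite -(sz g ag) dominant_rest.
  by rewrite fE msizeB_leq ?msizeZ_leq ?r.
have Lf : walk_op S a f = 0.
  by rewrite /f -scaleN1r walk_opD !walk_opZ LP LQ !scaler0 addr0.
have wf : vanish_walls alpha f.
  by move=> i x xi; rewrite /f pevalB pevalZ (vP _ _ xi) (vQ _ _ xi) mulr0 subr0.
have := dominant_neq0 f0; suff -> : dominant f = 0 by rewrite eqxx.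
apply: (harmonic_low_degree alpha_z fW av).
- exact: walk_harmonic_dominant a_sum1 a_drift0 a_cov1 _ Lf.
- exact: vanish_walls_dominant.
- by rewrite msize_dominant.
Qed.

(** * Existence in the plane, by solving for the terms of lower degree *)

Section Existence.
Hypotheses (d2 : d = 2%N) (fW : finite_set (wall_group alpha)) (av : avoids_open_cone alpha).

Let N := size (mirror_seq alpha).
Let wall_product : {mpoly R[d]} := \prod_i lform (alpha i).

Let wall_productM_vanish q : vanish_walls alpha (wall_product * q).
Proof.
move=> i x xi; rewrite pevalM peval_prod (bigD1 i) //= peval_lform xi.
by rewrite !mul0r.
Qed.

(** Multiplication by the two wall forms raises the degree by 2, which [walk_op] compensates; this
    makes [F] below an endomorphism. *)
Let msize_wall_product : msize wall_product = 3%N.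
Proof.
have w0 : wall_product != 0.
  by apply: prod_neq0 => i; apply/lform_neq0/(alpha_neq0 alpha_z).
suff : wall_product \is homog 2 by move=> /homog_msize; exact.
rewrite -d2 -[d in homog d]card_ord -sum1_card /wall_product.
by elim/big_ind2: _ => [|p1 q1 p2 q2|i _]; [exact: dhomog1|exact: dhomogM|exact: lform_homog].
Qed.

Lemma aplus_exists : exists P, aplus_polynomial S a C P.
Proof.
pose F q := walk_op S a (wall_product * q).
have FM q : (msize q <= N - 2)%N -> (msize (wall_product * q) <= N)%N.
  move=> qN; have [->|q0] := eqVneq q 0; first by rewrite mulr0 msize0.
  rewrite (leq_trans (msizeM_leq _ _)) // msize_wall_product.
  move: q0; rewrite -msize_poly_eq0; lia.
(* [q] is chosen to cancel [walk_op] of the root product, whose size is at most [N + 1 - 3] because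
   the root product is harmonic. *)
have [|||||q qN Fq] := @bounded_degree_surj R d (N - 2) F _ _ _ _ (- walk_op S a (root_product alpha z)).
- by move=> p q; rewrite /F mulrDr walk_opD.
- by move=> c q; rewrite /F -scalerAr walk_opZ.
- move=> q qN; rewrite /F (leq_trans (msize_walk_op a_sum1 a_drift0 a_cov1 _)) //.
  by rewrite leq_sub2r // FM.
(* For [q] in the kernel, the dominant term of [wall_product * q] is harmonic, vanishes on the walls
   and has degree below [N]. *)
- move=> q qN Fq; apply/eqP; apply: contraT => q0.
  have f0 : wall_product * q != 0 by rewrite mulf_neq0 // -msize_poly_eq0 msize_wall_product.
  have := dominant_neq0 f0; suff -> : dominant (wall_product * q) = 0 by rewrite eqxx.
  apply: (harmonic_low_degree alpha_z fW av).
  + exact: walk_harmonic_dominant a_sum1 a_drift0 a_cov1 _ Fq.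
  + exact/vanish_walls_dominant/wall_productM_vanish.
  + by rewrite msize_dominant FM.
- have lP := root_product_harmonic alpha_z fW av.
  rewrite msizeN (leq_trans (msize_walk_op_harmonic a_sum1 a_drift0 a_cov1 lP)) //.
  have := homog_msize_leq (root_product_homog alpha z); rewrite -/N; lia.
have hP := root_product_homog alpha z; have nP := root_product_neq0 alpha_z fW av.
have [_ dP] := dominant_lead hP nP (FM q qN).
exists (root_product alpha z + wall_product * q); split.
- rewrite -msize_poly_eq0; have [-> _] := dominant_lead hP nP (FM q qN); by [].
- by apply/harmonic_cone_walk_op; rewrite walk_opD -/(F q) Fq subrr.
- apply: walls_vanish_boundary => i x xi; rewrite pevalD (wall_productM_vanish _ xi) addr0.
  exact: (root_product_walls alpha_z fW av xi).
move=> x; rewrite (interior_cone alpha_z) dP => ox.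
exact: (root_product_pos alpha_z fW av ox).
Qed.

End Existence.
End WalkInCone.

(** * Plane cones *)

Section ComplexPower.
Variables (R : realType) (n : nat) (u e : 'cV[R]_n).
Hypotheses (uu : dot u u = 1) (ee : dot e e = 1) (ue : dot u e = 0).

(* Real and imaginary parts of [(<u, x> + i <e, x>) ^ k]. *)
Fixpoint cpow (k : nat) : {mpoly R[n]} * {mpoly R[n]} :=
  if k is k'.+1 then
    (lform u * (cpow k').1 - lform e * (cpow k').2, lform e * (cpow k').1 + lform u * (cpow k').2)
  else (1, 0).

(** The power rule, in real and imaginary parts: the derivative of the base in the [i]-th variable
    is the complex number with parts [u i 0] and [e i 0]. *)
Lemma mderiv_cpow i k :
  mderiv i (cpow k.+1).1 = k.+1%:R *: (u i 0 *: (cpow k).1 - e i 0 *: (cpow k).2) /\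
  mderiv i (cpow k.+1).2 = k.+1%:R *: (e i 0 *: (cpow k).1 + u i 0 *: (cpow k).2).
Proof.
have d1 : mderiv i (1 : {mpoly R[n]}) = 0 by rewrite -mpolyC1 mderivC.
elim: k => [|k [IH1 IH2]]; first by split;
  rewrite /= mulr0 ?mulr1 ?subr0 ?addr0 mderiv_lform scaler0 ?subr0 ?addr0 scale1r
    -mul_mpolyC mulr1.
move: IH1 IH2; set A := (cpow k.+1).1; set B := (cpow k.+1).2.
rewrite [(cpow k.+2).1]/= [(cpow k.+2).2]/= -/A -/B.
have AE : A = lform u * (cpow k).1 - lform e * (cpow k).2 by [].
have BE : B = lform e * (cpow k).1 + lform u * (cpow k).2 by [].
move=> IH1 IH2; rewrite mderivB mderivD !mderivM !mderiv_lform IH1 IH2 -!mul_mpolyC.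
rewrite !mpolyC_nat AE BE; set a := (cpow k).1; set b := (cpow k).2.
rewrite -[k.+2]addn1 natrD; split; ring.
Qed.

(** Two derivatives bring out the square of that complex number; summed over [i], it has real part
    [|u|^2 - |e|^2] and imaginary part [2 <u, e>], both zero. *)
Lemma lap_cpow k : lap (cpow k).1 = 0 /\ lap (cpow k).2 = 0.
Proof.
have d0 c : lap (mpolyC n c) = 0.
  by apply: big1 => i _; rewrite mderivC mderiv0.
case: k => [|[|k]].
- by rewrite /= -mpolyC0 -mpolyC1 !d0.
- split; apply: big1 => i _; have [d1 d2] := mderiv_cpow i 0;
    by rewrite ?d1 ?d2 /= scaler0 ?subr0 ?addr0 scale1r -mpolyC1 mderivZ mderivC scaler0.
set A := (cpow k).1; set B := (cpow k).2.
have uE : \sum_i u i 0 * u i 0 = 1 by exact: uu.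
have eE : \sum_i e i 0 * e i 0 = 1 by exact: ee.
have ueE : \sum_i u i 0 * e i 0 = 0 by exact: ue.
split.
- transitivity (\sum_i (k.+2%:R * k.+1%:R) *: ((u i 0 * u i 0) *: A - (e i 0 * e i 0) *: A
      - (2 * (u i 0 * e i 0)) *: B)).
    apply: eq_bigr => i _; have [d1' _] := mderiv_cpow i k.+1.
    rewrite d1' mderivZ mderivB !mderivZ; have [d1 d2] := mderiv_cpow i k; rewrite d1 d2.
    rewrite -/A -/B -!mul_mpolyC !mpolyCM !mpolyC_nat; ring.
  rewrite -scaler_sumr !sumrB -!scaler_suml -mulr_sumr uE eE ueE.
  by rewrite subrr mulr0 scale0r subr0 scaler0.
transitivity (\sum_i (k.+2%:R * k.+1%:R) *: ((u i 0 * u i 0) *: B - (e i 0 * e i 0) *: B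
    + (2 * (u i 0 * e i 0)) *: A)).
  apply: eq_bigr => i _; have [_ d2'] := mderiv_cpow i k.+1.
  rewrite d2' mderivZ mderivD !mderivZ; have [d1 d2] := mderiv_cpow i k; rewrite d1 d2.
  rewrite -/A -/B -!mul_mpolyC !mpolyCM !mpolyC_nat; ring.
rewrite -scaler_sumr big_split /= sumrB -!scaler_suml -mulr_sumr uE eE ueE.
by rewrite subrr mulr0 scale0r addr0 scaler0.
Qed.

Lemma peval_cpow k x r t : dot u x = r * cos t -> dot e x = r * sin t ->
  peval (cpow k).1 x = r ^+ k * cos (k%:R * t) /\
  peval (cpow k).2 x = r ^+ k * sin (k%:R * t).
Proof.
move=> ux ex; elim: k => [|k [IH1 IH2]].
  by rewrite /= peval0 mul0r cos0 sin0 mulr0 mulr1 -mpolyC1 pevalC expr0.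
rewrite /= pevalB pevalD !pevalM !peval_lform IH1 IH2 ux ex -natr1 mulrDl mul1r.
by rewrite sinD cosD exprS; split; ring.
Qed.

End ComplexPower.

(** * Plane cones whose angle divides the half-turn *)

Section Plane.
Variable R : realType.
Implicit Types (u v x : 'cV[R]_2).

Lemma dot2 u x : dot u x = u 0 0 * x 0 0 + u 1 0 * x 1 0.
Proof.
rewrite /dot big_ord_recl big_ord1; congr (_ + u _ 0 * x _ 0); exact: val_inj.
Qed.

Lemma sqr_le1_itv (t : R) : t ^+ 2 <= 1 -> -1 <= t <= 1.
Proof. by move=> t1; apply/andP; split; nra. Qed.

Lemma plane_reflection u v x : dot u u = 1 -> v != 0 -> dot v u = 0 ->
  reflection_mx v *m x = (2 * dot u x) *: u - x.
Proof.
(* [v] is [t] times the vector [u] turned by a right angle. *)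
move=> uu v0 vu; pose t := v 1 0 * u 0 0 - v 0 0 * u 1 0.
have v0E : v 0 0 = - t * u 1 0.
  rewrite /t -[LHS]mulr1 -uu; move: vu; rewrite !dot2 => vu.
  by rewrite -[LHS]subr0 -(mulr0 (u 0 0)) -vu; ring.
have v1E : v 1 0 = t * u 0 0.
  rewrite /t -[LHS]mulr1 -uu; move: vu; rewrite !dot2 => vu.
  by rewrite -[LHS]subr0 -(mulr0 (u 1 0)) -vu; ring.
have vv : dot v v = t ^+ 2.
  by rewrite dot2 v0E v1E -[RHS]mulr1 -uu dot2; ring.
have t0 : t != 0 by move: (dot_gt0 v0); rewrite vv exprn_even_gt0.
rewrite reflection_mulmx vv [dot v x]dot2 v0E v1E.
have e1 : u 1 0 * u 1 0 = 1 - u 0 0 * u 0 0 by rewrite -uu dot2; ring.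
have i2 (i : 'I_2) : i = 0 \/ i = 1.
  by case: i => [[|[|]]] // h; [left|right]; exact: val_inj.
apply/matrixP => i j; rewrite ord1 !mxE dot2 {j}.
by case: (i2 i) => ->; rewrite ?v0E ?v1E; field: e1 => //.
Qed.

Section Angle.
Variables (alpha z : 'I_2 -> 'cV[R]_2) (i j : 'I_2).
Hypotheses (alpha_z : forall i j, dot (alpha i) (z j) = (i == j)%:R)
  (expand_z : forall x, x = \sum_i dot (alpha i) x *: z i) (ij : i != j).

Variables (u w : 'cV[R]_2).
Hypotheses (uE : u = (eucl_norm (z i))^-1 *: z i) (wE : w = (eucl_norm (z j))^-1 *: z j).
Let c := dot u w.
Let theta := acos c.

Lemma ray_neq0 k : z k != 0.
Proof.
apply/eqP => z0; have := alpha_z k k; rewrite z0 dot0r eqxx => /esym/eqP.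
by rewrite oner_eq0.
Qed.

Lemma eucl_norm_gt0 v : v != 0 -> 0 < eucl_norm v.
Proof. by move=> v0; rewrite sqrtr_gt0 dot_gt0. Qed.

Lemma dot_unit v : v != 0 -> dot ((eucl_norm v)^-1 *: v) ((eucl_norm v)^-1 *: v) = 1.
Proof.
move=> v0; rewrite dotZl dotZr mulrA -invfM -expr2 sqr_sqrtr ?dot_ge0 // mulVf //.
by rewrite dot_eq0.
Qed.

Let uu : dot u u = 1. Proof. by rewrite uE dot_unit ?ray_neq0. Qed.
Let ww : dot w w = 1. Proof. by rewrite wE dot_unit ?ray_neq0. Qed.

Lemma vangleE : vangle (z i) (z j) = theta.
Proof.
by rewrite /vangle /theta /c uE wE dotZl dotZr mulrCA mulrA invfM mulrC [X in X * _]mulrC.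
Qed.

Lemma I2_cases k : k = i \/ k = j.
Proof.
have [->|ki] := eqVneq k i; [by left|right; apply: val_inj => /=].
move: ij ki; rewrite -!(inj_eq val_inj) /=.
by have := ltn_ord i; have := ltn_ord j; have := ltn_ord k; lia.
Qed.

Let alpha_comb a b : dot (alpha i) (a *: u + b *: w) = a / eucl_norm (z i) /\
  dot (alpha j) (a *: u + b *: w) = b / eucl_norm (z j).
Proof.
rewrite uE wE !dotDr !dotZr !alpha_z !eqxx [j == i]eq_sym (negPf ij) !mulr0 !mulr1.
by rewrite addr0 add0r.
Qed.

Lemma open_cone_comb a b : open_cone alpha (a *: u + b *: w) <-> 0 < a /\ 0 < b.
Proof.
have [ei ej] := alpha_comb a b.
have ni := eucl_norm_gt0 (ray_neq0 i); have nj := eucl_norm_gt0 (ray_neq0 j).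
split=> [ox|[a0 b0] k].
  by have := ox i; have := ox j; rewrite ei ej !pmulr_lgt0 ?invr_gt0.
by case: (I2_cases k) => ->; rewrite ?ei ?ej divr_gt0.
Qed.

Lemma combE x : x = (dot (alpha i) x * eucl_norm (z i)) *: u + (dot (alpha j) x * eucl_norm (z j)) *: w.
Proof.
rewrite {1}(expand_z x) (bigD1 i) //= (bigD1 j) //=; last by rewrite eq_sym.
rewrite big1 => [|k]; last by case: (I2_cases k) => ->; rewrite eqxx ?andbF.
by rewrite addr0 uE wE !scalerA !mulfK // gt_eqF // eucl_norm_gt0 // ray_neq0.
Qed.

(** Strict Cauchy-Schwarz inequality: [w - c *: u] is not zero, since [alpha j] is not orthogonal to
    it. *)
Let c2 : 0 < 1 - c ^+ 2.
Proof.
have -> : 1 - c ^+ 2 = dot (w - c *: u) (w - c *: u).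
  by rewrite !(dotBl, dotBr, dotZl, dotZr) uu ww -/c (dotC w u) -/c; ring.
apply: dot_gt0; apply/eqP => h; have [_] := alpha_comb (- c) 1.
rewrite scale1r scaleNr addrC h dot0r => /esym/eqP; rewrite mul1r invr_eq0.
by rewrite gt_eqF // eucl_norm_gt0 // ray_neq0.
Qed.

Let c_itv : -1 <= c <= 1.
Proof. by apply: sqr_le1_itv; have := c2; lra. Qed.

Let cos_theta : cos theta = c.
Proof. by rewrite acosK. Qed.

Let sin_theta : 0 < sin theta.
Proof. by rewrite sin_acos // sqrtr_gt0. Qed.

Let theta_gt0 : 0 < theta.
Proof. by rewrite lt_neqAle acos_ge0 // andbT; apply: contraTneq sin_theta => <-; rewrite sin0 ltxx. Qed.

Let theta_ltpi : theta < pi.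
Proof. by rewrite lt_neqAle acos_lepi // andbT; apply: contraTneq sin_theta => ->; rewrite sinpi ltxx. Qed.

(** In polar coordinates, the imaginary part of the [n]-th complex power is [r^n sin (n phi)]: zero
    for [phi = 0] and [phi = pi / n], positive in between. It thus serves as the positive harmonic
    polynomial. *)
Lemma wall_group_of_angle n : (0 < n)%N -> vangle (z i) (z j) = pi / n%:R ->
  finite_set (wall_group alpha) /\ avoids_open_cone alpha.
Proof.
rewrite vangleE => n0 thn; have npi : n%:R * theta = pi.
  by rewrite thn mulrCA mulfV ?mulr1 // pnatr_eq0 -lt0n.
pose s := sin theta; have s0 : s != 0 by rewrite gt_eqF.
have cs : c ^+ 2 + s ^+ 2 = 1 by rewrite -cos_theta cos2Dsin2.
(* [e] completes [u] to an orthonormal basis in which [w] has angle [theta]. *)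
pose e := s^-1 *: (w - c *: u).
have we : w = c *: u + s *: e by rewrite scalerA mulfV // scale1r addrC subrK.
have ue : dot u e = 0 by rewrite dotZr dotBr dotZr uu mulr1 subrr mulr0.
have ee : dot e e = 1.
  rewrite dotZl dotZr !(dotBl, dotBr, dotZl, dotZr) uu ww -/c (dotC w u) -/c.
  have -> : 1 - c * c - c * (c - c * 1) = s ^+ 2 by rewrite mulr1 -cs; ring.
  by field.
clearbody e.
pose h := (cpow u e n).2.
have lh : lap h = 0 by have [] := lap_cpow uu ee ue n.
have ux a b : dot u (a *: u + b *: w) = a + b * c by rewrite dotDr !dotZr uu mulr1.
have ex a b : dot e (a *: u + b *: w) = b * s.
  by rewrite we dotDr !dotZr dotDr !dotZr ee (dotC e u) ue; ring.
have wh : vanish_walls alpha h.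
  move=> k x xk; rewrite (combE x); set a := _ * _; set b := _ * _.
  have [ki|kj] := I2_cases k.
    have -> : a = 0 by rewrite /a -ki xk mul0r.
    have [||_ ->] := @peval_cpow _ _ u e n (0 *: u + b *: w) b theta.
    - by rewrite ux add0r cos_theta.
    - by rewrite ex.
    by rewrite npi sinpi mulr0.
  have -> : b = 0 by rewrite /b -kj xk mul0r.
  have [||_ ->] := @peval_cpow _ _ u e n (a *: u + 0 *: w) a 0.
  - by rewrite ux mul0r addr0 cos0 mulr1.
  - by rewrite ex mul0r sin0 mulr0.
  by rewrite mulr0 sin0 mulr0.
have hp x : open_cone alpha x -> 0 < peval h x.
  rewrite (combE x); set a := _ * _; set b := _ * _ => /open_cone_comb[a0 b0].
  (* [X] and [Y] are the coordinates along [u] and [e], and [r], [phi] the polar ones. Positivity of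
     [b] gives [0 < phi], and that of [a] gives [phi < theta] through
     [r * sin (theta - phi) = a * sin theta]. *)
  pose X := a + b * c; pose Y := b * s; have Y0 : 0 < Y by rewrite mulr_gt0.
  pose r := Num.sqrt (X ^+ 2 + Y ^+ 2).
  have r0 : 0 < r by rewrite sqrtr_gt0; nra.
  have rr : r ^+ 2 = X ^+ 2 + Y ^+ 2 by rewrite sqr_sqrtr //; nra.
  have Xr : -1 <= X / r <= 1.
    by apply: sqr_le1_itv; rewrite expr_div_n ler_pdivrMr ?exprn_gt0 // rr mul1r; nra.
  pose phi := acos (X / r).
  have cphi : X = r * cos phi by rewrite acosK // mulrCA mulfV ?mulr1 // gt_eqF.
  have sphi : Y = r * sin phi.
    have e1 : 1 - (X / r) ^+ 2 = (Y / r) ^+ 2.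
      by rewrite !expr_div_n rr; field; rewrite -rr expf_neq0 // gt_eqF.
    rewrite sin_acos // e1 sqrtr_sqr gtr0_norm ?divr_gt0 //.
    by rewrite mulrCA mulfV ?mulr1 // gt_eqF.
  have sphi0 : 0 < sin phi by rewrite -(pmulr_rgt0 _ r0) -sphi.
  have phi0 : 0 < phi.
    by rewrite lt_neqAle acos_ge0 // andbT; apply: contraTneq sphi0 => <-; rewrite sin0 ltxx.
  have phith : phi < theta.
    have dpos : 0 < sin (theta - phi).
      rewrite sinB -(pmulr_rgt0 _ r0) mulrBr mulrCA -cphi mulrCA -sphi cos_theta -/s.
      have -> : s * X - c * Y = a * s by rewrite /X /Y; ring.
      exact: mulr_gt0.
    rewrite ltNge; apply/negP => le; have : 0 <= sin (phi - theta).
      apply: sin_ge0_pi; rewrite subr_ge0 le /=.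
      have := acos_lepi Xr; rewrite -/phi => phipi.
      by rewrite lerBlDr (le_trans phipi) // lerDl ltW.
    by rewrite -opprB sinN oppr_ge0 leNgt dpos.
  have [||_ ->] := @peval_cpow _ _ u e n (a *: u + b *: w) r phi.
  - by rewrite ux.
  - by rewrite ex.
  rewrite mulr_gt0 ?exprn_gt0 // sin_gt0_pi // mulr_gt0 ?ltr0n //=.
  by rewrite -npi ltr_pM2l ?ltr0n.
split; last exact: (mirrors_avoid alpha_z lh wh hp).
apply: (finite_wall_group alpha_z expand_z); apply: (finite_mirror_reflections alpha_z lh wh).
by apply: contraTneq (hp _ (barycenter_open alpha_z)) => ->; rewrite peval0 ltxx.
Qed.

(** * The angle of a plane chamber, and its wall reflections *)

Section ChamberAngle.
Variable W : set 'M[R]_2.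
Hypotheses (cxW : finite_coxeter_group W) (chW : weyl_chamber W (cone alpha)).

Lemma coxeter_subgroup : orthogonal_subgroup W.
Proof.
have [_ [T Tr ->]] := cxW; apply: orthogonal_subgroup_smallest => A /Tr[v v0 ->].
exact: reflection_orthogonal.
Qed.

Lemma mirrors_reflect A x : W A -> mirrors W x -> mirrors W (A *m x).
Proof.
have [oW W1 WM WV] := coxeter_subgroup.
move=> WA [v [v0 Wv vx]]; have oA := oW _ WA; exists (A *m v); split.
- by rewrite -dot_eq0 orthogonal_dot // dot_eq0.
- by rewrite -reflection_conj // -orthogonal_inv //; apply: (WM _ _ (WM _ _ WA Wv)); exact: WV.
by rewrite /hyperplane /= orthogonal_dot.
Qed.

Lemma mirrorsZ a x : mirrors W x -> mirrors W (a *: x).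
Proof. by move=> [v [v0 Wv vx]]; exists v; split=> //; rewrite /hyperplane /= dotZr vx mulr0. Qed.

Lemma ray_mirror k : mirrors W (z k).
Proof.
apply: (weyl_chamber_boundary alpha_z cxW.1 chW).
  by move=> l; rewrite alpha_z ler0n.
have [l lk] : exists l, l != k by case: (I2_cases k) => ->; [exists j; rewrite eq_sym|exists i].
by move=> /(_ l); rewrite alpha_z (negPf lk) ltxx.
Qed.

Let ray k : 'cV[R]_2 :=
  (sin theta)^-1 *: (sin (k%:R * theta) *: w - sin ((k%:R - 1) * theta) *: u).

(* [ray k] is the unit vector at angle [k%:R * theta] from [u]; hence [ray k.+2]
   is the image of [ray k] by the reflection fixing [ray k.+1]. *)
Let ray_rec k : ray k.+2 = (2 * c) *: ray k.+1 - ray k.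
Proof.
have e t : sin (t + theta) = 2 * c * sin t - sin (t - theta).
  by rewrite sinD sinB cos_theta; ring.
rewrite /ray.
have -> : k.+2%:R * theta = k.+1%:R * theta + theta by rewrite -[k.+2]addn1 natrD; ring.
have -> : (k.+2%:R - 1) * theta = (k.+1%:R - 1) * theta + theta by rewrite -[k.+2]addn1 natrD; ring.
rewrite !e.
have -> : k.+1%:R * theta - theta = k%:R * theta by rewrite -[k.+1]addn1 natrD; ring.
have -> : (k.+1%:R - 1) * theta - theta = (k%:R - 1) * theta by rewrite -[k.+1]addn1 natrD; ring.
by apply/matrixP => l l'; rewrite !mxE; ring.
Qed.

Let ray0 : ray 0 = u.
Proof.
rewrite /ray mul0r sin0 scale0r sub0r sub0r mulN1r sinN scaleNr opprK scalerA mulVf ?scale1r //.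
by rewrite gt_eqF.
Qed.

Let ray1 : ray 1 = w.
Proof.
rewrite /ray mul1r subrr mul0r sin0 scale0r subr0 scalerA mulVf ?scale1r //.
by rewrite gt_eqF.
Qed.

Let ray_unit k : [/\ dot (ray k) (ray k) = 1, dot (ray k.+1) (ray k.+1) = 1 & dot (ray k) (ray k.+1) = c].
Proof.
elim: k => [|k [h0 h1 h2]]; first by rewrite ray0 ray1.
rewrite ray_rec; move: (ray k) (ray k.+1) h0 h1 h2 => p q h0 h1 h2.
rewrite !(dotBl, dotBr, dotZl, dotZr) (dotC q p) h0 h1 h2.
by split=> //; ring.
Qed.

(** The mirror through [ray k.+1] reflects [ray k] to [ray k.+2], and the group permutes its
    mirrors. *)
Let ray_mirrors k : mirrors W (ray k) /\ mirrors W (ray k.+1).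
Proof.
elim: k => [|k [h0 h1]]; first by rewrite ray0 ray1 uE wE; split; exact/mirrorsZ/ray_mirror.
split=> //; have [v [v0 Wv vr]] := h1; have [_ e1 e2] := ray_unit k.
have := mirrors_reflect Wv h0; rewrite (plane_reflection _ e1 v0 vr).
by rewrite dotC e2 -ray_rec.
Qed.

Lemma angle_of_chamber : exists2 n, (0 < n)%N & vangle (z i) (z j) = pi / n%:R.
Proof.
rewrite vangleE.
have ex : exists k, pi <= k%:R * theta.
  exists (Num.bound (pi / theta)); rewrite -ler_pdivrMr // ltW //.
  by apply: archi_boundP; rewrite divr_ge0 ?pi_ge0 ?ltW.
(* The least [n] for which the angle [n%:R * theta] reaches or passes the half-turn; the claim is
   that it reaches it exactly. *)
have := ex_minnP ex => -[n npi nmin].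
case: n npi nmin => [|[|n]] npi nmin.
- by have := pi_gt0 R; rewrite mul0r in npi; lra.
- by rewrite mul1r leNgt theta_ltpi in npi.
have n1 : n.+1%:R * theta < pi by rewrite ltNge; apply/negP => /nmin; rewrite ltnn.
exists n.+2 => //; suff -> : pi = n.+2%:R * theta by rewrite mulrAC mulfV ?mul1r // pnatr_eq0.
apply/eqP; rewrite eq_le npi /= leNgt; apply/negP => nlt.
have nth : n.+2%:R * theta = n.+1%:R * theta + theta by rewrite -[n.+2]addn1 natrD; ring.
have s1 : 0 < sin (n.+1%:R * theta) by rewrite sin_gt0_pi // n1 mulr_gt0 ?ltr0n.
have s2 : sin (n.+2%:R * theta) < 0.
  rewrite -[n.+2%:R * _](subrK pi) sinDpi oppr_lt0 sin_gt0_pi // subr_gt0 nlt /=.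
  by rewrite ltrBlDr nth; have := theta_ltpi; lra.
have [[v [v0 Wv vr]] _] := ray_mirrors n.+2.
(* This point is [- ray n.+2]. Its angle [n.+2%:R * theta - pi] is between 0 and [theta], so it is
   in the open cone although it is on a mirror. *)
have oc : open_cone alpha ((sin theta)^-1 * sin (n.+1%:R * theta) *: u
    + (sin theta)^-1 * - sin (n.+2%:R * theta) *: w).
  by apply/open_cone_comb; rewrite !mulr_gt0 ?invr_gt0 ?oppr_gt0.
have /eqP := weyl_chamber_avoids chW v0 Wv oc; apply.
have -> : (sin theta)^-1 * sin (n.+1%:R * theta) *: u
    + (sin theta)^-1 * - sin (n.+2%:R * theta) *: w = - ray n.+2.
  rewrite /ray -[X in (X - 1) * _]natr1 addrK -scalerN opprB scalerBr !scalerA.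
  by rewrite mulrN scaleNr.
by rewrite dotNr vr oppr0.
Qed.

(** Each edge lies on a mirror, which in the plane is the line of that edge, hence a wall. So the
    wall reflections belong to [W], and both properties pass to the group that they generate. *)
Lemma wall_group_of_chamber : finite_set (wall_group alpha) /\ avoids_open_cone alpha.
Proof.
have [oW W1 WM WV] := coxeter_subgroup.
have wW k : W (reflection_mx (alpha k)).
  have [l lk] : exists l, l != k by case: (I2_cases k) => ->; [exists j; rewrite eq_sym|exists i].
  have [v [v0 Wv vl]] := ray_mirror l.
  have kl m : m != l -> m = k.
    by move: lk; case: (I2_cases m) => ->; case: (I2_cases l) => ->; case: (I2_cases k) => ->;
      rewrite ?eqxx.
  have ev : v = dot (z k) v *: alpha k.
    rewrite {1}(expand_alpha alpha_z expand_z v) (bigD1 k) //= big1 ?addr0 // => m mk.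
    suff -> : m = l by rewrite dotC [dot v _]vl scale0r.
    by apply/eqP; apply: contraNT mk => /kl ->.
  have vk : dot (z k) v != 0 by apply: contraNneq v0 => h; rewrite ev h scale0r.
  by rewrite -(reflection_scale _ vk) -ev.
have sub : wall_group alpha `<=` W.
  by apply: smallest_sub => // A [k ->].
split; first by apply: sub_finite_set sub _; exact: cxW.1.
by move=> v v0 /sub Wv x ox; exact: (weyl_chamber_avoids chW).
Qed.

End ChamberAngle.
End Angle.
End Plane.

(** * The cone of a linear automorphism *)

(** The [alpha i] are the rows of the inverse matrix of [Z], that is, the basis dual to the images
    of the canonical basis. *)
Lemma orthant_image_cone (R : realType) (d : nat)
    (Z : {linear 'cV[R]_d -> 'cV[R]_d}) : bijective Z ->
  exists alpha : 'I_d -> 'cV[R]_d,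
    [/\ forall i j, dot (alpha i) (Z (delta_mx j 0)) = (i == j)%:R,
        forall x, x = \sum_i dot (alpha i) x *: Z (delta_mx i 0) &
        Z @` orthant R d = cone alpha].
Proof.
move=> [f fK Kf].
pose M := \matrix_(i < d, j < d) Z (delta_mx j 0) i 0.
pose M' := \matrix_(i < d, j < d) f (delta_mx j 0) i 0.
have ZE x : Z x = \sum_j x j 0 *: Z (delta_mx j 0).
  have {1}-> : x = \sum_j x j 0 *: delta_mx j 0.
    apply/matrixP => i j; rewrite ord1 summxE (bigD1 i) //= big1 => [|k ki].
      by rewrite !mxE !eqxx mulr1 addr0.
    by rewrite !mxE eq_sym (negPf ki) mulr0.
  by rewrite raddf_sum; apply: eq_bigr => j _; exact: linearZ.
have ZM x : Z x = M *m x.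
  rewrite ZE; apply/matrixP => i j; rewrite ord1 summxE mxE.
  by apply: eq_bigr => k _; rewrite !mxE mulrC.
have M'M : M' *m M = 1%:M.
  apply: mulmx1C; apply/matrixP => i j.
  have := congr1 (fun y : 'cV[R]_d => y i 0) (Kf (delta_mx j 0)).
  rewrite ZM !mxE eqxx andbT => <-; apply: eq_bigr => k _.
  by rewrite !mxE.
exists (fun i => (row i M')^T).
have aZ i x : dot (row i M')^T (Z x) = x i 0.
  by rewrite dotE trmxK ZM mulmxA -row_mul M'M -row_mul mul1mx mxE.
have eZ x : x = \sum_i dot (row i M')^T x *: Z (delta_mx i 0).
  by rewrite -(Kf x) {1}ZE; apply: eq_bigr => i _; rewrite aZ.
split=> //; first by move=> i j; rewrite aZ mxE eqxx andbT.
apply/seteqP; split=> [_ [x ox <-] i|y cy]; first by rewrite aZ; exact: ox.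
exists (f y); last exact: Kf.
by move=> i; rewrite -(aZ i) Kf; exact: cy.
Qed.

(** * Transfer of the plane results to a dimension [d] with [d = 2] *)

Section PlanarChamber.
Variables (R : realType) (d : nat) (alpha z : 'I_d -> 'cV[R]_d).
Hypotheses (d2 : d = 2%N) (alpha_z : forall i j, dot (alpha i) (z j) = (i == j)%:R)
  (expand_z : forall x, x = \sum_i dot (alpha i) x *: z i).

Lemma planar_chamber_wall_group : is_finite_coxeter_chamber (cone alpha) ->
  finite_set (wall_group alpha) /\ avoids_open_cone alpha.
Proof.
move: alpha z alpha_z expand_z; rewrite d2 => al zz al_zz ex_zz [W cxW chW].
exact: (wall_group_of_chamber (i := 0) (j := 1) al_zz ex_zz isT cxW chW).
Qed.

Lemma planar_chamber_angle : is_finite_coxeter_chamber (cone alpha) <->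
  exists2 n : nat, (0 < n)%N & forall i j, i != j -> vangle (z i) (z j) = pi / n%:R.
Proof.
move: alpha z alpha_z expand_z; rewrite d2 => al zz al_zz ex_zz; split.
  move=> [W cxW chW].
  have [n n0 an] := angle_of_chamber al_zz (i := 0) (j := 1) isT (erefl _) (erefl _) cxW chW.
  exists n => // i j ij.
  have vC u v : vangle u v = vangle v u :> R by rewrite /vangle dotC [eucl_norm u * _]mulrC.
  have I2 := I2_cases (i := 0) (j := 1) isT.
  by move: ij; case: (I2 i) => ->; case: (I2 j) => ->; rewrite ?eqxx // => _; rewrite vC.
move=> [n n0 an].
have [fW av] := wall_group_of_angle al_zz ex_zz (i := 0) (j := 1) isT (erefl _) (erefl _) n0 (an 0 1 isT).
exact: chamber_cone al_zz fW av.
Qed.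

End PlanarChamber.

Theorem theorem1 (R : realType) (d : nat) (d_ge2 : (2 <= d)%N)
  (Z : {linear 'cV[R]_d -> 'cV[R]_d}) (Z_bij : bijective Z)
  (C : set 'cV[R]_d) (C_def : C = Z @` orthant R d)
  (S : {fset 'cV[R]_d}) (a : 'cV[R]_d -> R)
  (a_ge0 : forall s, s \in S -> 0 <= a s)
  (a_sum1 : \sum_(s <- S) a s = 1)
  (a_drift0 : \sum_(s <- S) a s *: s = 0)
  (a_cov1 : forall i j : 'I_d,
      \sum_(s <- S) a s * (s i 0 * s j 0) = (i == j)%:R) :
  (* (i) *)
  (forall P : {mpoly R[d]}, aplus_polynomial S a C P ->
     (forall Q : {mpoly R[d]}, aplus_polynomial S a C Q ->
        exists2 c : R, 0 < c & Q = c *: P) /\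
     is_finite_coxeter_chamber C)
  /\
  (* (ii) *)
  (d = 2%N ->
     (is_finite_coxeter_chamber C <->
        exists2 n : nat, (0 < n)%N &
          forall i j : 'I_d, i != j ->
            vangle (Z (delta_mx i 0)) (Z (delta_mx j 0)) = pi / n%:R) /\
     (is_finite_coxeter_chamber C ->
        exists P : {mpoly R[d]}, aplus_polynomial S a C P)).
Proof.
(* [C] becomes the simplicial cone whose edge vectors are the images of the canonical basis. *)
have [alpha [alpha_z expand_z CE]] := orthant_image_cone Z_bij.
set z := fun i => Z (delta_mx i 0) in alpha_z expand_z.
rewrite C_def CE; split.
  move=> P aP; split; first by move=> Q; exact: (aplus_unique alpha_z expand_z a_sum1 a_drift0 a_cov1 aP).
  have [fW av] := aplus_wall_group alpha_z expand_z a_sum1 a_drift0 a_cov1 aP.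
  exact: chamber_cone alpha_z fW av.
move=> d2; split; first exact: planar_chamber_angle d2 alpha_z expand_z.
move=> /(planar_chamber_wall_group d2 alpha_z expand_z)[fW av].
exact: (aplus_exists alpha_z a_sum1 a_drift0 a_cov1 d2 fW av).
Qed.
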